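(* Let $n,n'\ge1$ be integers and $W=\mathbb{C}^n\otimes\mathbb{C}^{n'}$. Let $Y=(w_{ij})_{1\le i\le n,\,1\le j\le n'}$ be the matrix with entries in $\bar T(W)$ formed by the canonical basis of $W$, let $I_n=(1,2,\ldots,n)$, and put $$\mathcal{I}=\bigl\{\operatorname{column-det}Y_{I_n^\circ J^\circ}\ \big|\ J=(j_1,\ldots,j_n),\ 1\le j_1\le\cdots\le j_n\le n'\bigr\}.$$ Then: (i) The algebra $\bar T(W)^{SL_n(\mathbb{C})}$ of $SL_n(\mathbb{C})$-invariants is generated by $\mathcal{I}$ and $S_\infty$. (ii) The algebra $T(W)^{SL_n(\mathbb{C})}$ is spanned by the elements of the form $A_1\cdots A_k\,\sigma$, where $k\ge0$, $A_1,\ldots,A_k\in\mathcal{I}$ and $\sigma\in S_{kn}$.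
   Context: Permutations multiply by composition; $S_\infty$ is the inductive limit of $S_0\subset S_1\subset\cdots$. The symbol $\otimes$ is omitted in tensors, and vectors are numbered from right to left. $W^{\otimes p}$ is a right $\mathbb{C}S_p$-module by $v_p\cdots v_1\,\sigma=v_{\sigma(p)}\cdots v_{\sigma(1)}$. Put $\bar T_p(W)=W^{\otimes p}\otimes_{\mathbb{C}S_p}\mathbb{C}S_\infty$ (so $\bar T_0(W)=\mathbb{C}S_\infty\supset S_\infty$) and $\bar T(W)=\bigoplus_{p\ge0}\bar T_p(W)$, an associative graded algebra with product $$(v_p\cdots v_1\,\sigma)(v'_{p'}\cdots v'_1\,\sigma')=v_p\cdots v_1v'_{p'}\cdots v'_1\,\alpha^{p'}(\sigma)\sigma',$$ where $\alpha$ is the group endomorphism of $S_\infty$ with $\alpha(\sigma)(1)=1$, $\alpha(\sigma)(k)=\sigma(k-1)+1$ for $k\ge2$. The ordinary tensor algebra $T(W)=\bigoplus_pW^{\otimes p}$ is a subalgebra of $\bar T(W)$. $SL_n(\mathbb{C})\subset GL_n(\mathbb{C})$ acts on $W=\mathbb{C}^n\otimes\mathbb{C}^{n'}$ canonically on the first factor and trivially on the second, hence on $\bar T(W)$ and $T(W)$ by algebra automorphisms $g(v_p\cdots v_1\sigma)=(gv_p)\cdots(gv_1)\sigma$. The canonical basis of $W$ is $w_{ij}$. For an $r\times r$ matrix $X$ over a not necessarily commutative algebra, $\operatorname{column-det}X=\sum_{\sigma\in S_r}\operatorname{sgn}(\sigma)X_{\sigma(1)1}X_{\sigma(2)2}\cdots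 X_{\sigma(r)r}$. For $I=(i_1,\ldots,i_r)$, $J=(j_1,\ldots,j_r)$: $X_{IJ}=(X_{i_aj_b})_{1\le a,b\le r}$, $I^\circ=(i_r,\ldots,i_1)$, $J^\circ=(j_r,\ldots,j_1)$. The element $A_1\cdots A_k$ lies in $W^{\otimes kn}$, on which $S_{kn}$ acts from the right. *)

(* Defs.v *)
From HB Require Import structures.
From mathcomp Require Import freeg.
From mathcomp Require Import all_boot all_order all_algebra.
From mathcomp Require Import fingroup perm.
From mathcomp Require Import finmap.
From mathcomp Require Import boolp classical_sets reals.
From mathcomp Require Import complex.

Set Implicit Arguments.
Unset Strict Implicit.
Unset Printing Implicit Defensive.

Import GRing.Theory.
Local Open Scope ring_scope.
Local Open Scope quotient_scope.

Section Closures.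
Variable K : comNzRingType.

Definition lin_span (V : lmodType K) (G : set V) : set V :=
  smallest (fun S : set V => GRing.submod_closed (mem S)) G.

Definition gen_subalg (A : algType K) (G : set A) : set A :=
  smallest (fun S : set A => GRing.subalg_closed (mem S)) G.

Lemma lin_span_gen (V : lmodType K) (G : set V) x : G x -> lin_span G x.
Proof. exact: sub_gen_smallest. Qed.

Lemma lin_span_submod (V : lmodType K) (G : set V) :
  GRing.submod_closed (mem (lin_span G)).
Proof.
split=> [|a x y].
  by rewrite inE => S [[S0 _] _]; rewrite inE in S0.
rewrite !inE => Gx Gy S [cS GS].
have Sx := Gx S (conj cS GS); have Sy := Gy S (conj cS GS).
by have [_ /(_ a x y)] := cS; rewrite !inE; apply.
Qed.

Lemma lin_span_ind (V : lmodType K) (G P : set V) :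
    (forall x, G x -> P x) -> P 0 ->
    (forall a x y, P x -> P y -> P (a *: x + y)) ->
  forall x, lin_span G x -> P x.
Proof.
move=> GP P0 PL x; apply; split=> //; split=> [|a u v]; rewrite !inE //.
exact: PL.
Qed.

End Closures.

(* S_infinity: finitely supported permutations.  The points are numbered
   from 0 instead of 1, i.e. the point k is represented by k.-1.
   An injective finitely supported map is a bijection. *)
Definition Sinf := {f : {fsfun nat -> nat} | fsinjectiveb f}.
HB.instance Definition _ := Choice.on Sinf.

Definition sfun (s : Sinf) : nat -> nat := val s.
Coercion sfun : Sinf >-> Funclass.

Lemma Sinf_eqP (s t : Sinf) : s =1 t <-> s = t.
Proof. by split=> [st|-> //]; apply: val_inj; apply/fsfunP. Qed.

Lemma Sinf_inj (s : Sinf) : injective s.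
Proof. exact/fsinjectiveP/valP. Qed.

Fact Sinf_one_subproof : fsinjectiveb ([fsfun] : {fsfun nat -> nat}).
Proof. by apply/fsinjectiveP => i j; rewrite !fsfun0E. Qed.
Definition Sinf_one : Sinf := Sub [fsfun] Sinf_one_subproof.

Fact Sinf_mul_subproof (s t : Sinf) : fsinjectiveb (fsfun_comp (val s) (val t)).
Proof. exact/fsinjectiveP/fscomp_inj/Sinf_inj/Sinf_inj. Qed.
Definition Sinf_mul (s t : Sinf) : Sinf := Sub _ (Sinf_mul_subproof s t).

Lemma Sinf_mulE (s t : Sinf) k : Sinf_mul s t k = s (t k).
Proof. exact: fscompE. Qed.
Lemma Sinf_oneE k : Sinf_one k = k.
Proof. exact: fsfun0E. Qed.

Lemma Sinf_surj (s : Sinf) k : exists j, s j = k.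
Proof.
have [kS|kNS] := boolP (k \in finsupp (val s)); last first.
  by exists k; apply: fsfun_dflt.
have /imfset_eq_fsinjectiveP e := valP s.
by move: kS; rewrite -{1}e => /imfsetP[j /= _ ->]; exists j.
Qed.

Definition Sinf_pre (s : Sinf) k : nat := projT1 (cid (Sinf_surj s k)).

Lemma Sinf_preK (s : Sinf) : cancel (Sinf_pre s) s.
Proof. by move=> k; rewrite /Sinf_pre; case: cid. Qed.

Definition Sinf_inv_fun (s : Sinf) : {fsfun nat -> nat} :=
  [fsfun k in finsupp (val s) => Sinf_pre s k].

Lemma Sinf_inv_funE s k : Sinf_inv_fun s k = Sinf_pre s k.
Proof.
rewrite fsfunE; case: ifPn => // kNS; apply: (@Sinf_inj s).
by rewrite Sinf_preK; apply: fsfun_dflt.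
Qed.

Fact Sinf_inv_subproof s : fsinjectiveb (Sinf_inv_fun s).
Proof.
apply/fsinjectiveP => i j; rewrite !Sinf_inv_funE => e.
by rewrite -(Sinf_preK s i) e Sinf_preK.
Qed.
Definition Sinf_inv (s : Sinf) : Sinf := Sub _ (Sinf_inv_subproof s).

Lemma Sinf_invK (s : Sinf) k : s (Sinf_inv s k) = k.
Proof. by rewrite -[RHS](Sinf_preK s); congr (s _); apply: Sinf_inv_funE. Qed.

Fact Sinf_mulA : associative Sinf_mul.
Proof. by move=> r s t; apply/Sinf_eqP => k; rewrite !Sinf_mulE. Qed.
Fact Sinf_mul1 : left_id Sinf_one Sinf_mul.
Proof. by move=> s; apply/Sinf_eqP => k; rewrite Sinf_mulE Sinf_oneE. Qed.
Fact Sinf_mulr1 : right_id Sinf_one Sinf_mul.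
Proof. by move=> s; apply/Sinf_eqP => k; rewrite Sinf_mulE Sinf_oneE. Qed.
Fact Sinf_mulrV : right_inverse Sinf_one Sinf_inv Sinf_mul.
Proof.
by move=> s; apply/Sinf_eqP => k; rewrite Sinf_mulE Sinf_invK Sinf_oneE.
Qed.
Fact Sinf_mulVr : left_inverse Sinf_one Sinf_inv Sinf_mul.
Proof.
move=> s; apply/Sinf_eqP => k; apply: (@Sinf_inj s).
by rewrite Sinf_mulE Sinf_invK Sinf_oneE.
Qed.

HB.instance Definition _ :=
  isGroup.Build Sinf Sinf_mulA Sinf_mul1 Sinf_mulr1 Sinf_mulVr Sinf_mulrV.

Lemma SinfM (s t : Sinf) k : (s * t : Sinf)%g k = s (t k).
Proof. exact: Sinf_mulE. Qed.
Lemma Sinf1 k : (1%g : Sinf) k = k.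
Proof. exact: Sinf_oneE. Qed.

(* S_p, as a subset of S_infinity: it permutes the points 0, ..., p - 1. *)
Definition Sfin (p : nat) : set Sinf :=
  [set s | forall k, (p <= k)%N -> s k = k].

(* The endomorphism alpha: it fixes the first point and moves the others like
   s does, one step further. *)
Definition alpha_fun (s : Sinf) : {fsfun nat -> nat} :=
  [fsfun k in [fset j.+1 | j in finsupp (val s)]%fset => (s k.-1).+1].

Lemma alpha_funE (s : Sinf) k : alpha_fun s k = if k is j.+1 then (s j).+1 else 0%N.
Proof.
rewrite fsfunE; case: ifPn => [/imfsetP[j /= _ ->] //|].
case: k => // j; apply: contraNeq => ne; apply/imfsetP; exists j => //=.
by rewrite mem_finsupp; apply: contra ne => /eqP e; rewrite eqSS eq_sym; apply/eqP.
Qed.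

Fact alpha_subproof s : fsinjectiveb (alpha_fun s).
Proof.
by apply/fsinjectiveP => -[|i] [|j]; rewrite !alpha_funE // => -[/Sinf_inj->].
Qed.
Definition alpha (s : Sinf) : Sinf := Sub _ (alpha_subproof s).

Lemma alphaE (s : Sinf) k : alpha s k = if k is j.+1 then (s j).+1 else 0%N.
Proof. exact: alpha_funE. Qed.
Lemma alphaM (s t : Sinf) : alpha (s * t)%g = (alpha s * alpha t)%g.
Proof. by apply/Sinf_eqP => -[|k]; rewrite SinfM !alphaE // SinfM. Qed.
Lemma alpha1 : alpha 1%g = 1%g.
Proof. by apply/Sinf_eqP => -[|k]; rewrite alphaE !Sinf1. Qed.
Lemma iter_alphaE p (s : Sinf) k :
  iter p alpha s k = if (k < p)%N then k else (s (k - p) + p)%N.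
Proof.
elim: p k => [|p IH] k; first by rewrite subn0 addn0.
by rewrite iterS alphaE; case: k => // k; rewrite IH ltnS subSS; case: ifP; rewrite // addnS.
Qed.
Lemma iter_alphaM p s t :
  iter p alpha (s * t)%g = (iter p alpha s * iter p alpha t)%g.
Proof. by elim: p => // p /= ->; rewrite alphaM. Qed.
Lemma iter_alpha1 p : iter p alpha 1%g = 1%g.
Proof. by elim: p => // p /= ->; rewrite alpha1. Qed.

(* The list [:: v_p; ...; v_1] stands for the word v_p ... v_1: the letters are
   numbered from right to left, hence the reversals.  Only meaningful when s
   belongs to S_p, in which case the default value x is never reached. *)
Definition word_perm (T : Type) (u : seq T) (s : Sinf) : seq T :=
  if u is x :: _ then rev [seq nth x (rev u) (s k) | k <- iota 0 (size u)]
  else [::].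

Lemma size_word_perm T (u : seq T) s : size (word_perm u s) = size u.
Proof. by case: u => // x u; rewrite size_rev size_map size_iota. Qed.

Lemma nth_word_perm T (x0 : T) (u : seq T) (s : Sinf) k : Sfin (size u) s ->
  nth x0 (rev (word_perm u s)) k = nth x0 (rev u) (s k).
Proof.
case: u => [|x u] sf; first by rewrite !nth_nil.
have [lt|ge] := ltnP k (size (x :: u)); last first.
  by rewrite sf // !nth_default // size_rev ?size_word_perm.
rewrite revK (nth_map 0%N) ?size_iota // nth_iota // add0n; apply: set_nth_default.
rewrite size_rev ltnNge; apply/negP => /[dup] le /sf /Sinf_inj e.
by move: le; rewrite e leqNgt lt.
Qed.

Lemma map_word_perm T U (f : T -> U) u s : Sfin (size u) s ->
  map f (word_perm u s) = word_perm (map f u) s.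
Proof.
case: u => // x u sf; rewrite -[LHS]revK -[RHS]revK; congr rev.
apply: (@eq_from_nth _ (f x)).
  by rewrite !(size_rev, size_map, size_word_perm).
move=> k; rewrite !(size_rev, size_map, size_word_perm) => lt.
rewrite [RHS]nth_word_perm ?size_map // -!map_rev.
have ltk : (s k < size (rev (x :: u)))%N.
  rewrite size_rev ltnNge; apply/negP => /[dup] le /sf /Sinf_inj e.
  by move: le; rewrite e leqNgt lt.
rewrite (nth_map x); last by rewrite size_rev size_word_perm.
by rewrite [RHS](nth_map x _ _ ltk) nth_word_perm.
Qed.

Lemma Sfin_lt p (s : Sinf) k : Sfin p s -> (s k < p)%N = (k < p)%N.
Proof.
move=> sf; apply/idP/idP => lt; rewrite ltnNge; apply/negP => le.
  by move: lt; rewrite sf // ltnNge le.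
by move: lt; rewrite -(Sinf_inj (sf _ le)) ltnNge le.
Qed.

Section FreeModule.
Variables (K : comNzRingType) (G : choiceType).
Notation F := {freeg G / K}.

Definition fgU (a : G) : F := Freeg [:: (1, a)].

Lemma fgUZ (c : K) a : Freeg [:: (c, a)] = c *: fgU a.
Proof. by apply/eqP/freeg_eqP => z; rewrite coeffZ !coeffU mul1r. Qed.

Lemma fgU_ind (P : F -> Prop) : P 0 ->
  (forall c a x, P x -> P (c *: fgU a + x)) -> forall x, P x.
Proof.
move=> P0 PL x; rewrite -(freeg_sumE x).
by elim/big_rec: _ => // a y _ Py; rewrite fgUZ; apply: PL.
Qed.

Variables (M : lmodType K) (f : G -> M).

Lemma fgliftU a : fglift f (fgU a) = f a.
Proof. by rewrite /fgU liftU scale1r. Qed.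

Lemma fglift_is_linear : linear (fglift f).
Proof.
have fB : zmod_morphism (fglift f) by exact: lift_is_additive.
have f0 : fglift f 0 = 0 by rewrite -[in LHS](subrr 0) fB subrr.
have fD : {morph fglift f : x y / x + y}.
  move=> x y; have /esym/eqP := fB (x + y) y.
  by rewrite addrK subr_eq => /eqP.
have fZ c x : fglift f (c *: x) = c *: fglift f x.
  elim/fgU_ind: x => [|d a x IH]; first by rewrite scaler0 f0 scaler0.
  rewrite scalerDr !fD IH scalerDr scalerA -!fgUZ !liftU.
  by rewrite scalerA.
by move=> c x y; rewrite fD fZ.
Qed.

HB.instance Definition _ := GRing.isLinear.Build K F M _ (fglift f) fglift_is_linear.

End FreeModule.

Lemma linear_fgU_ext (K : comNzRingType) (G : choiceType) (M : lmodType K)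
    (f g : {linear {freeg G / K} -> M}) :
  (forall a, f (fgU K a) = g (fgU K a)) -> f =1 g.
Proof.
move=> fg x; elim/fgU_ind: x => [|c a x IH]; first by rewrite !linear0.
by rewrite !linearP fg IH.
Qed.

Definition monoid_alg (K : comNzRingType) (G : monoidType) : Type := {freeg G / K}.

Section MonoidAlgebra.
Variables (K : comNzRingType) (G : monoidType).
HB.instance Definition _ := GRing.Lmodule.on (monoid_alg K G).
Notation A := (monoid_alg K G).
Implicit Types (x y z : A) (a b c : G).

Definition ma_of (a : G) : A := fgU K a.

Definition ma_mul x y : A :=
  fglift (fun a => fglift (fun b => ma_of (a * b)%g) y) x.

Fact ma_mulP y : linear (ma_mul^~ y).
Proof. exact: fglift_is_linear. Qed.

Fact ma_mulPr x : linear (ma_mul x).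
Proof.
move=> k y z; rewrite /ma_mul; elim/fgU_ind: x => [|c a x IH].
  by rewrite !linear0 addr0.
rewrite !fglift_is_linear {}IH !fgliftU fglift_is_linear !scalerDr !scalerA.
by rewrite (mulrC c) addrACA.
Qed.

Fact ma_mul0l y : ma_mul 0 y = 0.
Proof. exact: linear0. Qed.

Fact ma_mul0r x : ma_mul x 0 = 0.
Proof. by have := ma_mulPr x (-1) 0 0; rewrite !scaleN1r oppr0 addr0 addNr. Qed.

Lemma ma_mulU a b : ma_mul (ma_of a) (ma_of b) = ma_of (a * b)%g.
Proof. by rewrite /ma_mul !fgliftU. Qed.

Fact ma_mulA : associative ma_mul.
Proof.
move=> x y z; elim/fgU_ind: x => [|k a x IH]; first by rewrite !ma_mul0l.
rewrite !ma_mulP {}IH; congr (_ *: _ + _).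
elim/fgU_ind: y => [|l b y IH]; first by rewrite ma_mul0l !ma_mul0r ma_mul0l.
rewrite !(ma_mulP z, ma_mulPr (fgU K a)) {}IH; congr (_ *: _ + _).
elim/fgU_ind: z => [|m c z IH]; first by rewrite !ma_mul0r.
by rewrite !ma_mulPr {}IH !ma_mulU mulgA.
Qed.

Fact ma_mul1 : left_id (ma_of 1%g) ma_mul.
Proof.
move=> x; elim/fgU_ind: x => [|c a x IH]; first exact: ma_mul0r.
by rewrite ma_mulPr IH ma_mulU mul1g.
Qed.

Fact ma_mulr1 : right_id (ma_of 1%g) ma_mul.
Proof.
move=> x; elim/fgU_ind: x => [|c a x IH]; first exact: ma_mul0l.
by rewrite ma_mulP IH ma_mulU mulg1.
Qed.

Fact ma_mulDl : left_distributive ma_mul +%R.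
Proof. by move=> x y z; have := ma_mulP z 1 x y; rewrite !scale1r. Qed.
Fact ma_mulDr : right_distributive ma_mul +%R.
Proof. by move=> x y z; have := ma_mulPr x 1 y z; rewrite !scale1r. Qed.

Fact ma_1_neq0 : ma_of 1%g != 0.
Proof.
apply/eqP => /(congr1 (coeff 1%g)); rewrite coeffU coeff0 mul1r eqxx => /eqP.
by rewrite oner_eq0.
Qed.

HB.instance Definition _ := GRing.Zmodule_isNzRing.Build A
  ma_mulA ma_mul1 ma_mulr1 ma_mulDl ma_mulDr ma_1_neq0.

Fact ma_scaleAl (k : K) x y : k *: (x * y) = (k *: x) * y.
Proof.
by have := ma_mulP y k x 0; rewrite addr0 ma_mul0l addr0 => e; exact: esym e.
Qed.
HB.instance Definition _ := GRing.Lmodule_isLalgebra.Build K A ma_scaleAl.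
Fact ma_scaleAr (k : K) x y : k *: (x * y) = x * (k *: y).
Proof.
by have := ma_mulPr x k y 0; rewrite addr0 ma_mul0r addr0 => e; exact: esym e.
Qed.
HB.instance Definition _ := GRing.Lalgebra_isAlgebra.Build K A ma_scaleAr.

Lemma ma_ofM a b : ma_of (a * b)%g = ma_of a * ma_of b.
Proof. by rewrite -ma_mulU. Qed.
Lemma ma_of1 : ma_of 1%g = 1.
Proof. by []. Qed.

End MonoidAlgebra.

Lemma rev_nth_ext (T : Type) (x0 : T) (u v : seq T) : size u = size v ->
  (forall k, (k < size u)%N -> nth x0 (rev u) k = nth x0 (rev v) k) -> u = v.
Proof.
move=> suv uv; rewrite -[u]revK -[v]revK; congr rev.
by apply: (@eq_from_nth _ x0); rewrite !size_rev.
Qed.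

Lemma Sfin_catl p q (t : Sinf) : Sfin p t -> Sfin (q + p) t.
Proof. by move=> tp k le; apply/tp/(leq_trans (leq_addl _ _) le). Qed.

Lemma Sfin_iter_alpha p q (t : Sinf) : Sfin p t -> Sfin (p + q) (iter q alpha t).
Proof.
move=> tp k le; rewrite iter_alphaE ltnNge (leq_trans (leq_addl _ _) le) /=.
by rewrite tp ?subnK ?leq_subRL // ?(leq_trans (leq_addl _ _) le) // addnC.
Qed.

Lemma Sfin_commute p (s t : Sinf) : Sfin p t ->
  (t * iter p alpha s = iter p alpha s * t)%g.
Proof.
move=> tp; apply/Sinf_eqP => k; rewrite !SinfM !iter_alphaE Sfin_lt //.
case: ltnP => // le; rewrite (tp k) //; apply: tp; exact: leq_addl.
Qed.

Lemma word_perm_catr (T : Type) (x0 : T) (w u : seq T) (t : Sinf) :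
  Sfin (size u) t -> word_perm (w ++ u) t = w ++ word_perm u t.
Proof.
move=> tu; apply: (rev_nth_ext (x0 := x0)) => [|k _].
  by rewrite !(size_word_perm, size_cat).
rewrite nth_word_perm; last by rewrite size_cat; apply: Sfin_catl.
rewrite !rev_cat !nth_cat !size_rev size_word_perm Sfin_lt //.
by case: ltnP => [_|le]; rewrite ?nth_word_perm // tu.
Qed.

Lemma word_perm_catl (T : Type) (x0 : T) (u w : seq T) (t : Sinf) :
  Sfin (size u) t ->
  word_perm (u ++ w) (iter (size w) alpha t) = word_perm u t ++ w.
Proof.
move=> tu; apply: (rev_nth_ext (x0 := x0)) => [|k _].
  by rewrite !(size_word_perm, size_cat).
rewrite nth_word_perm; last by rewrite size_cat; apply: Sfin_iter_alpha.
rewrite !rev_cat !nth_cat !size_rev iter_alphaE.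
case: (ltnP k) => [->//|le]; rewrite ltnNge leq_addl /= addnK.
by rewrite nth_word_perm.
Qed.

(* The pair (u, s) stands for the decomposable element v_p ... v_1 (x) s, with
   u the word v_p ... v_1; pairs are multiplied by the rule defining the product
   of Tbar(W). *)
Definition tword (T : choiceType) : Type := (seq T * Sinf)%type.

Section TwistedWords.
Variable T : choiceType.
HB.instance Definition _ := Choice.on (tword T).

Definition tword_mul (a b : tword T) : tword T :=
  (a.1 ++ b.1, (iter (size b.1) alpha a.2 * b.2)%g).

Definition tword_one : tword T := ([::], 1%g).

Fact tword_mulA : associative tword_mul.
Proof.
move=> [u s] [v t] [w r]; rewrite /tword_mul /= catA; congr (_, _).
by rewrite iter_alphaM size_cat addnC iterD mulgA.
Qed.
Fact tword_mul1 : left_id tword_one tword_mul.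
Proof. by case=> u s; rewrite /tword_mul /= iter_alpha1 mul1g. Qed.
Fact tword_mulr1 : right_id tword_one tword_mul.
Proof. by case=> u s; rewrite /tword_mul /= cats0 mulg1. Qed.

HB.instance Definition _ :=
  isMonoid.Build (tword T) tword_mulA tword_mul1 tword_mulr1.
End TwistedWords.

Section Tbar.
Variables (K : comNzRingType) (W : lmodType K).
Notation A := (monoid_alg K (tword W)).

Definition tgen (u : seq W) (s : Sinf) : A := ma_of K ((u, s) : tword W).

(* The relations defining the direct sum over p of the tensor products over the
   group algebra of S_p of the p-th tensor power of W with the group algebra of
   S_infinity: multilinearity of the words, and vt (x) s = v (x) ts for v a word
   of length p and t in S_p. *)
Inductive tbar_rel : set A :=
| TbarRelLinear u v a x y s :
    tbar_rel (tgen (u ++ (a *: x + y) :: v) s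
              - (a *: tgen (u ++ x :: v) s + tgen (u ++ y :: v) s))
| TbarRelPerm u (t : Sinf) s : Sfin (size u) t ->
    tbar_rel (tgen (word_perm u t) s - tgen u (t * s)%g).

Definition tbar_ideal : pred A := fun x => x \in lin_span tbar_rel.

Fact tbar_ideal_submod : GRing.subsemimod_closed tbar_ideal.
Proof. exact/GRing.submod_closed_semi/lin_span_submod. Qed.

HB.instance Definition _ :=
  GRing.isSubmodClosed.Build K A tbar_ideal tbar_ideal_submod.

Lemma tbar_idealP x : reflect (lin_span tbar_rel x) (x \in tbar_ideal).
Proof. by apply: (iffP idP); rewrite unfold_in /tbar_ideal inE. Qed.

Lemma tgenM u s v t :
  tgen u s * tgen v t = tgen (u ++ v) (iter (size v) alpha s * t)%g.
Proof. by rewrite -ma_ofM. Qed.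

Lemma tgen_ind (P : A -> Prop) : P 0 ->
  (forall c u s x, P x -> P (c *: tgen u s + x)) -> forall x, P x.
Proof. by move=> P0 PL; apply: fgU_ind => // c [u s]; apply: PL. Qed.

Fact tbar_idealMl x y : y \in tbar_ideal -> x * y \in tbar_ideal.
Proof.
move=> /tbar_idealP; move: y.
apply: (lin_span_ind (P := fun y => x * y \in tbar_ideal)) => [y yR||a y z]; last 2 first.
- by rewrite mulr0 rpred0.
- by move=> yI zI; rewrite mulrDr -scalerAr rpredD ?rpredZ.
elim/tgen_ind: x => [|c w r x IH]; first by rewrite mul0r rpred0.
rewrite mulrDl -scalerAl rpredD ?rpredZ {IH x}//; apply/tbar_idealP; apply: lin_span_gen.
case: yR => [u v a x y' s|u t s tu]; rewrite mulrBr ?mulrDr -?scalerAr !tgenM.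
  by rewrite !size_cat /= !catA; apply: TbarRelLinear.
rewrite size_word_perm -(word_perm_catr 0) // mulgA -(Sfin_commute _ tu) -mulgA.
by apply: TbarRelPerm; rewrite size_cat; apply: Sfin_catl.
Qed.

Fact tbar_idealMr x y : x \in tbar_ideal -> x * y \in tbar_ideal.
Proof.
move=> /tbar_idealP; move: x.
apply: (lin_span_ind (P := fun x => x * y \in tbar_ideal)) => [x xR||a x z]; last 2 first.
- by rewrite mul0r rpred0.
- by move=> yI zI; rewrite mulrDl -scalerAl rpredD ?rpredZ.
elim/tgen_ind: y => [|c w r y IH]; first by rewrite mulr0 rpred0.
rewrite mulrDr -scalerAr rpredD ?rpredZ {IH y}//; apply/tbar_idealP; apply: lin_span_gen.
case: xR => [u v a x' y s|u t s tu]; rewrite mulrBl ?mulrDl -?scalerAl !tgenM.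
  by rewrite -!catA; apply: TbarRelLinear.
rewrite -(word_perm_catl 0) // iter_alphaM -mulgA.
by apply: TbarRelPerm; rewrite size_cat; apply: Sfin_iter_alpha.
Qed.

Local Notation Tq := (@ring_quotient.Quotient.quot A (GRing.ZmodClosed.clone A tbar_ideal _)).
Definition tbar : Type := Tq.
HB.instance Definition _ := GRing.Zmodule.on tbar.


Definition tbar_pi (x : A) : tbar := \pi_(Tq) x.
Definition tbar_repr (x : tbar) : A := generic_quotient.repr (x : Tq).

Lemma tbar_reprK x : tbar_pi (tbar_repr x) = x.
Proof. exact: reprK. Qed.

Lemma tbar_piP x y : tbar_pi x = tbar_pi y <-> x - y \in tbar_ideal.
Proof.
have e := ring_quotient.Quotient.idealrBE (GRing.ZmodClosed.clone A tbar_ideal _) x y.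
by split=> [xy|xyI]; [rewrite e; apply/eqP | apply/eqP; rewrite -e].
Qed.

Lemma tbar_reprP x : tbar_repr (tbar_pi x) - x \in tbar_ideal.
Proof. by apply/tbar_piP; rewrite tbar_reprK. Qed.

Fact tbar_piB : zmod_morphism tbar_pi.
Proof. by move=> x y; rewrite /tbar_pi !piE. Qed.

Lemma tbar_ind (P : tbar -> Prop) : (forall x, P (tbar_pi x)) -> forall x, P x.
Proof. by move=> Ppi x; rewrite -[x]tbar_reprK. Qed.

Definition tbar_mul (x y : tbar) : tbar := tbar_pi (tbar_repr x * tbar_repr y).
Definition tbar_scale (a : K) (x : tbar) : tbar := tbar_pi (a *: tbar_repr x).

Lemma tbar_mulE x y : tbar_mul (tbar_pi x) (tbar_pi y) = tbar_pi (x * y).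
Proof.
apply/tbar_piP; rewrite -[_ - _](subrKA (tbar_repr (tbar_pi x) * y)).
rewrite -mulrBr -mulrBl rpredD //; first exact/tbar_idealMl/tbar_reprP.
exact/tbar_idealMr/tbar_reprP.
Qed.

Lemma tbar_scaleE a x : tbar_scale a (tbar_pi x) = tbar_pi (a *: x).
Proof. by apply/tbar_piP; rewrite -scalerBr rpredZ // tbar_reprP. Qed.

HB.instance Definition _ := GRing.isZmodMorphism.Build A tbar tbar_pi tbar_piB.

Fact tbar_scaleA a b x : tbar_scale a (tbar_scale b x) = tbar_scale (a * b) x.
Proof. by elim/tbar_ind: x => x; rewrite !tbar_scaleE scalerA. Qed.
Fact tbar_scale1 : left_id 1 tbar_scale.
Proof. by elim/tbar_ind => x; rewrite tbar_scaleE scale1r. Qed.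
Fact tbar_scaleDr : right_distributive tbar_scale +%R.
Proof.
move=> a; elim/tbar_ind => x; elim/tbar_ind => y.
by rewrite -raddfD !tbar_scaleE -raddfD scalerDr.
Qed.
Fact tbar_scaleDl x : {morph tbar_scale^~ x : a b / a + b}.
Proof.
by elim/tbar_ind: x => x a b; rewrite !tbar_scaleE -raddfD scalerDl.
Qed.
HB.instance Definition _ := GRing.Zmodule_isLmodule.Build K tbar
  tbar_scaleA tbar_scale1 tbar_scaleDr tbar_scaleDl.

Fact tbar_mulA : associative tbar_mul.
Proof.
by elim/tbar_ind => x; elim/tbar_ind => y; elim/tbar_ind => z;
  rewrite !tbar_mulE mulrA.
Qed.
Fact tbar_mul1 : left_id (tbar_pi 1) tbar_mul.
Proof. by elim/tbar_ind => x; rewrite tbar_mulE mul1r. Qed.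
Fact tbar_mulr1 : right_id (tbar_pi 1) tbar_mul.
Proof. by elim/tbar_ind => x; rewrite tbar_mulE mulr1. Qed.
Fact tbar_mulDl : left_distributive tbar_mul +%R.
Proof.
by elim/tbar_ind => x; elim/tbar_ind => y; elim/tbar_ind => z;
  rewrite -raddfD !tbar_mulE -raddfD mulrDl.
Qed.
Fact tbar_mulDr : right_distributive tbar_mul +%R.
Proof.
by elim/tbar_ind => x; elim/tbar_ind => y; elim/tbar_ind => z;
  rewrite -raddfD !tbar_mulE -raddfD mulrDr.
Qed.

Fact tbar_1_neq0 : tbar_pi 1 != 0.
Proof.
apply/eqP; rewrite -(raddf0 tbar_pi) => /tbar_piP; rewrite subr0 => /tbar_idealP.
pose e : A -> K^o := fglift (fun a : tword W => (a.1 == [::])%:R : K^o).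
have eL : linear e by exact: fglift_is_linear.
pose eE : {linear A -> K^o} := HB.pack e (GRing.isLinear.Build K A K^o _ e eL).
have eU u s : eE (tgen u s) = (u == [::])%:R by exact: fgliftU.
suff e0 x : lin_span tbar_rel x -> eE x = 0.
  by move=> /e0; rewrite [eE 1](eU [::] 1%g) => /eqP; rewrite oner_eq0.
move: x; apply: (lin_span_ind (P := fun x => eE x = 0)) => [x||a x y ex ey]; last 2 first.
- exact: linear0.
- rewrite linearP ex ey addr0; exact: mulr0.
case=> [u v a x1 y s|u t s tu]; rewrite linearB ?(linearP eE) !eU.
  have uz z : (u ++ z :: v == [::]) = false by case: u.
  rewrite !uz; suff e0 : (0 : K) - (a * 0 + 0) = 0 by exact: e0.
  by rewrite mulr0 addr0 subrr.
by rewrite -!size_eq0 size_word_perm subrr.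
Qed.
HB.instance Definition _ := GRing.Zmodule_isNzRing.Build tbar
  tbar_mulA tbar_mul1 tbar_mulr1 tbar_mulDl tbar_mulDr tbar_1_neq0.

Fact tbar_scaleAl (a : K) (x y : tbar) : a *: (x * y) = (a *: x) * y.
Proof.
elim/tbar_ind: x => x; elim/tbar_ind: y => y.
rewrite -[LHS]/(tbar_scale a (tbar_mul _ _)).
rewrite -[RHS]/(tbar_mul (tbar_scale _ _) _).
by rewrite !(tbar_mulE, tbar_scaleE) scalerAl.
Qed.
HB.instance Definition _ := GRing.Lmodule_isLalgebra.Build K tbar tbar_scaleAl.
Fact tbar_scaleAr (a : K) (x y : tbar) : a *: (x * y) = x * (a *: y).
Proof.
elim/tbar_ind: x => x; elim/tbar_ind: y => y.
rewrite -[LHS]/(tbar_scale a (tbar_mul _ _)).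
rewrite -[RHS]/(tbar_mul _ (tbar_scale _ _)).
by rewrite !(tbar_mulE, tbar_scaleE) scalerAr.
Qed.
HB.instance Definition _ := GRing.Lalgebra_isAlgebra.Build K tbar tbar_scaleAr.

Fact tbar_pi_monoid_morphism : monoid_morphism tbar_pi.
Proof. by split=> // x y; rewrite -tbar_mulE. Qed.
HB.instance Definition _ :=
  GRing.isMonoidMorphism.Build A tbar tbar_pi tbar_pi_monoid_morphism.
Fact tbar_pi_scalable : scalable tbar_pi.
Proof. by move=> a x; rewrite -tbar_scaleE. Qed.
HB.instance Definition _ := GRing.isScalable.Build K A tbar _ tbar_pi tbar_pi_scalable.

Definition tb (u : seq W) (s : Sinf) : tbar := tbar_pi (tgen u s).

Lemma tbM u s v t : tb u s * tb v t = tb (u ++ v) (iter (size v) alpha s * t)%g.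
Proof. by rewrite -rmorphM tgenM. Qed.

Lemma tb1 : tb [::] 1%g = 1.
Proof. by []. Qed.

Lemma tb_linear u v a x y s :
  tb (u ++ (a *: x + y) :: v) s = a *: tb (u ++ x :: v) s + tb (u ++ y :: v) s.
Proof.
rewrite -linearP; apply/tbar_piP/tbar_idealP; apply: lin_span_gen.
exact: TbarRelLinear.
Qed.

Lemma tb_perm u (t : Sinf) s : Sfin (size u) t ->
  tb (word_perm u t) s = tb u (t * s)%g.
Proof. by move=> tu; apply/tbar_piP/tbar_idealP; apply: lin_span_gen; apply: TbarRelPerm. Qed.

Lemma tb_ind (P : tbar -> Prop) : P 0 ->
  (forall c u s x, P x -> P (c *: tb u s + x)) -> forall x, P x.
Proof.
move=> P0 PL; apply: tbar_ind => x; elim/tgen_ind: x => [|c u s x IH].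
  by rewrite raddf0.
by rewrite linearP; apply: PL.
Qed.

Section Lift.
Variables (M : lmodType K) (f : seq W -> Sinf -> M).
Hypothesis f_linear : forall u v a x y s,
  f (u ++ (a *: x + y) :: v) s = a *: f (u ++ x :: v) s + f (u ++ y :: v) s.
Hypothesis f_perm : forall u (t : Sinf) s, Sfin (size u) t ->
  f (word_perm u t) s = f u (t * s)%g.

Definition tbar_lift (x : tbar) : M :=
  fglift (fun a : tword W => f a.1 a.2) (tbar_repr x).

Let fl : {linear A -> M} := HB.pack (fglift (fun a : tword W => f a.1 a.2))
  (GRing.isLinear.Build K A M _ _ (fglift_is_linear (fun a : tword W => f a.1 a.2))).

Let fl_tgen u s : fl (tgen u s) = f u s. Proof. exact: fgliftU. Qed.

Let fl_ideal x : x \in tbar_ideal -> fl x = 0.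
Proof.
move=> /tbar_idealP; move: x.
apply: (lin_span_ind (P := fun x => fl x = 0)) => [x||a x y ex ey]; last 2 first.
- exact: linear0.
- by rewrite (linearP fl) ex ey scaler0 addr0.
case=> [u v a x1 y s|u t s tu]; rewrite (linearB fl) ?(linearP fl) !fl_tgen.
  by rewrite f_linear subrr.
by rewrite f_perm ?subrr.
Qed.

Lemma tbar_lift_pi x : tbar_lift (tbar_pi x) = fl x.
Proof. by apply/eqP; rewrite -subr_eq0 -(linearB fl) fl_ideal // tbar_reprP. Qed.

Lemma tbar_lift_linear : linear tbar_lift.
Proof.
move=> a; elim/tbar_ind => x; elim/tbar_ind => y.
by rewrite -linearP !tbar_lift_pi linearP.
Qed.

Lemma tbar_lift_tb u s : tbar_lift (tb u s) = f u s.
Proof. by rewrite tbar_lift_pi fl_tgen. Qed.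
End Lift.

(* The copies of S_infinity and of the ordinary tensor algebra T(W) in Tbar(W). *)
Definition tbS (s : Sinf) : tbar := tb [::] s.

Lemma tb_mulS u (s : Sinf) : Sfin (size u) s ->
  tb u 1%g * tbS s = tb (word_perm u s) 1%g.
Proof. by move=> su; rewrite tb_perm // mulg1 tbM cats0 mul1g. Qed.

Lemma tbSM s t : tbS (s * t)%g = tbS s * tbS t.
Proof. by rewrite tbM. Qed.

Definition tensor_alg : set tbar := lin_span [set tb u 1%g | u in setT].

End Tbar.

(* Functoriality of Tbar(W) in W: v_p ... v_1 s |-> f(v_p) ... f(v_1) s. *)
Section TbarMap.
Variables (K : comNzRingType) (W W' : lmodType K) (f : {linear W -> W'}).

Definition tbar_map : tbar W -> tbar W' := tbar_lift (fun u s => tb (map f u) s).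

Fact tbar_map_rel1 u v a x y s :
  tb (map f (u ++ (a *: x + y) :: v)) s =
  a *: tb (map f (u ++ x :: v)) s + tb (map f (u ++ y :: v)) s.
Proof. by rewrite !map_cat /= linearP tb_linear. Qed.
Fact tbar_map_rel2 u (t : Sinf) s : Sfin (size u) t ->
  tb (map f (word_perm u t)) s = tb (map f u) (t * s)%g.
Proof. by move=> tu; rewrite map_word_perm // tb_perm // size_map. Qed.

Lemma tbar_map_tb u s : tbar_map (tb u s) = tb (map f u) s.
Proof. exact: (tbar_lift_tb tbar_map_rel1 tbar_map_rel2). Qed.

Fact tbar_map_linear : linear tbar_map.
Proof. exact: (tbar_lift_linear tbar_map_rel1 tbar_map_rel2). Qed.
HB.instance Definition _ :=
  GRing.isLinear.Build K (tbar W) (tbar W') _ tbar_map tbar_map_linear.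

Fact tbar_map_monoid_morphism : monoid_morphism tbar_map.
Proof.
split=> [|x y]; first exact: tbar_map_tb.
elim/tb_ind: x => [|c u s x IH]; first by rewrite mul0r linear0 mul0r.
rewrite mulrDl -scalerAl !tbar_map_linear IH mulrDl -scalerAl; congr (_ *: _ + _).
elim/tb_ind: y {IH} => [|d v t y IH]; first by rewrite mulr0 linear0 mulr0.
rewrite mulrDr -scalerAr !tbar_map_linear IH mulrDr -scalerAr; congr (_ *: _ + _).
by rewrite tbM !tbar_map_tb tbM map_cat size_map.
Qed.
HB.instance Definition _ := GRing.isMonoidMorphism.Build (tbar W) (tbar W')
  tbar_map tbar_map_monoid_morphism.

End TbarMap.

(* The products are taken in the order of increasing column index. *)
Definition column_det (A : nzRingType) (r : nat) (X : 'M[A]_r) : A :=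
  \sum_(s : 'S_r) (-1) ^+ s * \prod_(b < r) X (s b) b.

(* X_{IJ} *)
Definition submx_seq (A : Type) (m m' r : nat) (X : 'M[A]_(m, m'))
    (I : r.-tuple 'I_m) (J : r.-tuple 'I_m') : 'M[A]_r :=
  mxsub (tnth I) (tnth J) X.

Section SLInvariants.
Variables (K : comNzRingType) (n n' : nat).

(* W = K^n (x) K^n' is the space of n x n' matrices, with w_ij = delta_mx i j;
   the matrix g acts on the first factor by left multiplication. *)
Notation W := 'M[K]_(n, n').

Definition gl_act (g : 'M[K]_n) : tbar W -> tbar W := tbar_map (mulmx g).

Definition SL_invariants : set (tbar W) :=
  [set x | forall g : 'M[K]_n, \det g = 1 -> gl_act g x = x].

Definition Ymx : 'M[tbar W]_(n, n') :=
  \matrix_(i, j) tb [:: delta_mx i j : W] 1%g.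

Definition det_gens : set (tbar W) :=
  [set x | exists2 J : n.-tuple 'I_n', sorted leq (map val J) &
     x = column_det (submx_seq Ymx (rev_tuple (ord_tuple n)) (rev_tuple J))].

End SLInvariants.

Arguments tbS {K} W s.
Arguments tensor_alg {K} W.
Arguments SL_invariants K n n' : clear implicits.
Arguments Ymx K n n' : clear implicits.
Arguments det_gens K n n' : clear implicits.

(* Main.v *)
Require Import Defs.
From HB Require Import structures.
From mathcomp Require Import freeg.
From mathcomp Require Import all_boot all_order all_algebra.
From mathcomp Require Import fingroup perm finmap.
From mathcomp Require Import boolp classical_sets reals complex.
From mathcomp Require Import separable cyclic cyclotomic.

Set Implicit Arguments.
Unset Strict Implicit.
Unset Printing Implicit Defensive.

Import GRing.Theory.
Local Open Scope ring_scope.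
Local Open Scope classical_set_scope.

(** Why the theorem is true.

    The S_infinity-module structure is on the right and SL_n acts on the
    letters, so everything reduces to one operator on Tbar(W) which is a finite
    linear combination of actions of matrices and which plays the role of a
    Reynolds operator; it is Cayley's Omega process, written as a finite
    difference.

    Tbar(W) is graded and the action respects the grading, so let x be an
    invariant of degree m.  Scalar matrices of determinant 1 act on x by the
    m-th powers of the n-th roots of unity, so x = 0 unless n divides m.  If
    m = k * n, then an invertible h is a scalar l with l ^+ n = \det h times a
    matrix of determinant 1, hence h x = (\det h) ^+ k *: x.  Both sides are
    polynomial in h of degree k * n.  Their complete polarizations at
    (g_1, ..., g_(kn)), computed as an alternating sum over the subsets S of
    the values at t + \sum_(a in S) g_a, therefore agree: the shift t does not
    change the top finite difference, and it makes all these matrices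
    invertible.

    Specialize the g_a, for a = (b, r) ranging over k blocks of n positions, to
    the elementary matrices E_(p_b r, r), where p_1, ..., p_k are permutations,
    and add up with the sign of p_1 ... p_k.  This is [omega].
    - On a word, [omega] gives a sum over the permutations of the letters; each
      term is a product of k determinants with values in the row vectors of the
      letters, followed by the permutation ([sum_blocks_det], [omega_word]).
    - On an invariant, [omega] is multiplication by the number
      Omega^k (\det ^ k) ([omega_invariant]).  It is a sum of squares, one of
      them positive ([omega_const_neq0]).
    Hence every invariant is a combination of elements (product of k
    determinants) * s, and if it lies in the ordinary tensor algebra, which has
    words with trivial permutation, then s can be taken in S_(kn).
    Determinants are multilinear in their rows, and permuting the rows amounts
    to a sign and a permutation of the letters, so the determinants with
    weakly increasing columns suffice ([det_tensor_span]).  Permutations move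
    to the right across words, through alpha ([det_products_prod]).

    Conversely a determinant is multiplied by \det g under the action of g
    ([gl_act_det_gens]), so that all the generators are invariant. *)

(** * Polarization as an alternating sum over subsets *)

(** Expanding the product over i of 1 - [i \notin B] gives these terms. *)
Lemma sum_sign_supersets (R : comNzRingType) (T : finType) (B : {set T}) :
  \sum_(S : {set T} | B \subset S) (-1) ^+ #|~: S| = (B == [set: T]%SET)%:R :> R.
Proof.
transitivity (\prod_(i : T) (1 + - (i \notin B)%:R : R)); last first.
  have [->|/eqP/setP neT] := eqVneq B [set: T]%SET.
    by rewrite big1 // => i _; rewrite inE subr0.
  have [i iB] : exists i, i \notin B.
    apply/existsP; apply: contra_notT neT; rewrite negb_exists => /forallP h i.
    by move: (h i); rewrite negbK inE => ->.
  by rewrite (bigD1 i) //= iB subrr mul0r.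
rewrite [LHS]big_mkcond bigA_distr; apply: eq_big => // S _.
case: ifPn => [BS|/fintype.subsetPn[i iB iS]]; last first.
  by rewrite (bigD1 i) //= (negPf iS) iB oppr0 mul0r.
rewrite (bigID (mem S)) /= big1 ?mul1r => [|i ->] //.
rewrite [RHS](eq_bigr (fun=> -1)) => [|i iS].
  by rewrite prodr_const; congr (_ ^+ _); apply: eq_card => i; rewrite !inE.
by rewrite (negPf iS) (contra (fintype.subsetP BS i)).
Qed.

Definition partial_values p (f : {ffun 'I_p -> option 'I_p}) : {set 'I_p} :=
  [set a | Some a \in codom f].

(** A function f : 'I_p -> option 'I_p records which summand of
    h + \sum_(a in S) g_a is picked in each of the p factors, None standing for
    h.  By inclusion-exclusion only those f survive that pick every g_a; as there
    are p factors, each is then picked once, and h never. *)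
Lemma polarization (K : comNzRingType) (M : lmodType K) p
    (F : {ffun 'I_p -> option 'I_p} -> M) :
  \sum_(S : {set 'I_p}) (-1) ^+ #|~: S| *: \sum_(f | partial_values f \subset S) F f
  = \sum_(s : 'S_p) F [ffun i => Some (s i)].
Proof.
under eq_bigr do rewrite scaler_sumr.
rewrite (exchange_big_dep xpredT) //=.
under eq_bigr => f _ do rewrite -scaler_suml sum_sign_supersets.
(* The surviving f are the image of 'S_p under h. *)
pose h (s : 'S_p) : {ffun 'I_p -> option 'I_p} := [ffun i => Some (s i)].
have h_inj : injective h.
  move=> s t /ffunP st; apply/permP => i; have := st i.
  by rewrite !ffunE => -[].
rewrite -(big_imset (h := h) (A := predT) F) /=; last by move=> s t _ _ /h_inj.
rewrite [RHS]big_mkcond /=; apply: eq_bigr => f _.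
suff -> : (f \in [set h x | x in predT]%SET) = (partial_values f == [set: _]%SET).
  by case: eqP; rewrite ?scale1r ?scale0r.
apply/imsetP/eqP => [[s _ ->]|/setP fT].
  apply/setP => a; rewrite !inE; apply/codomP; exists ((s^-1)%g a).
  by rewrite ffunE permKV.
have fS a : exists i, f i == Some a.
  have := fT a; rewrite !inE => /codomP[i fi].
  by exists i; rewrite -fi.
pose g a := xchoose (fS a).
have fg a : f (g a) = Some a by apply/eqP/(xchooseP (fS a)).
have g_inj : injective g by move=> a b /(congr1 f); rewrite !fg => -[].
exists (perm g_inj)^-1%g => //; apply/ffunP => i; rewrite ffunE -fg.
by congr (f _); rewrite -[LHS](permKV (perm g_inj)) permE.
Qed.

(** * Cutting 'I_(k * n) into k blocks of n positions *)

Section Blocks.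
Variables k n : nat.

Fact block_subproof (a : 'I_(k * n)) : (a %/ n < k)%N.
Proof.
case: n a => [|m] a; first by case: a => i; rewrite muln0.
by rewrite ltn_divLR.
Qed.
Definition block (a : 'I_(k * n)) : 'I_k := Ordinal (block_subproof a).

Fact place_subproof (a : 'I_(k * n)) : (a %% n < n)%N.
Proof.
by rewrite ltn_mod; case: n a => [|m] a; first by case: a => i; rewrite muln0.
Qed.
Definition place (a : 'I_(k * n)) : 'I_n := Ordinal (place_subproof a).

Fact position_subproof (b : 'I_k) (r : 'I_n) : (b * n + r < k * n)%N.
Proof.
apply: (@leq_trans (b * n + n)); first by rewrite ltn_add2l.
by rewrite -mulSnr leq_mul2r ltn_ord orbT.
Qed.
Definition position b r : 'I_(k * n) := Ordinal (position_subproof b r).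

Lemma block_position b r : block (position b r) = b.
Proof.
by apply: val_inj; rewrite /= divnMDl ?divn_small ?addn0 //; case: n r => // -[].
Qed.
Lemma place_position b r : place (position b r) = r.
Proof. by apply: val_inj; rewrite /= modnMDl modn_small. Qed.

(** The factors keep their order, as products of letters do not commute; a
    bijection of the index sets would not be enough. *)
Lemma prod_blocks (A : nzRingType) (F : 'I_(k * n) -> A) :
  \prod_a F a = \prod_b \prod_r F (position b r).
Proof.
pose G (m : nat) := if insub m is Some a then F a else 1.
have GE a : G (val a) = F a by rewrite /G valK.
transitivity (\prod_(0 <= m < k * n) G m).
  by rewrite big_mkord; apply: eq_bigr => a _; rewrite -GE.
rewrite big_nat_mul big_mkord; apply: eq_bigr => b _.
rewrite -{1}[(b * n)%N]add0n big_addn mulSn addnK big_mkord.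
by apply: eq_bigr => r _; rewrite -GE addnC.
Qed.

End Blocks.

(** * Shifts and roots of unity *)

(** The characteristic polynomials of the - M i have finitely many roots. *)
Lemma exists_det_shift_neq0 (K : numFieldType) (T : finType) (n : nat)
    (M : T -> 'M[K]_n) :
  exists t : K, forall i, \det (t%:M + M i) != 0.
Proof.
have charE t i : (char_poly (- M i)).[t] = \det (t%:M + M i).
  rewrite -horner_evalE -det_map_mx; congr (\det _); apply/matrixP => r c.
  by rewrite !mxE /= /horner_eval hornerD hornerN hornerC opprK hornerMn hornerX.
pose P := \prod_i char_poly (- M i).
have P0 : P != 0 by apply/monic_neq0/monic_prod => i _; apply: char_poly_monic.
pose ts : seq K := [seq j%:R | j <- iota 0 (size P)].
have ts_uniq : uniq ts.
  by rewrite map_inj_uniq ?iota_uniq // => i j /eqP; rewrite Num.Theory.eqr_nat => /eqP.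
have /allPn[t _ tP] : ~~ all (root P) ts.
  apply/negP => /(max_poly_roots P0)/(_ ts_uniq).
  by rewrite size_map size_iota ltnn.
exists t => i; rewrite -charE; apply: contra tP => /eqP Pi.
by rewrite /root horner_prod (bigD1 i) //= Pi mul0r.
Qed.

(** ['X^n - 1] is separable, so it has n distinct roots in K, and these form a
    cyclic group. *)
Lemma exists_prim_root (K : closedFieldType) n : (0 < n)%N -> n%:R != 0 :> K ->
  exists z : K, n.-primitive_root z.
Proof.
move=> n0 nK; have [rs] := closed_field_poly_normal ('X^n - 1 : {poly K}).
rewrite (monicP (monic_Xn_sub_1 K n0)) scale1r => E.
have rsU : uniq rs by rewrite -separable_prod_XsubC -E separable_Xn_sub_1.
have rs_size : (n <= size rs)%N.
  by rewrite -ltnS -(size_prod_XsubC rs id) -E size_Xn_sub_1.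
have rs_root : all n.-unity_root rs.
  by apply/allP => z zrs; rewrite unity_rootE -subr_eq0; move: zrs;
    rewrite -root_prod_XsubC -E /root !hornerE.
by have /hasP[z _ zn] := has_prim_root n0 rs_root rsU rs_size; exists z.
Qed.

(** * The constant Omega^k (det^k) *)

Definition reindex_ffun (I : finType) (Y : Type) (s : {perm I}) (f : {ffun I -> Y}) :=
  [ffun i => f (s i)].

(** With w the sum of v over the permutations of its argument, w is invariant
    under these permutations, so that #|{perm I}| copies of the inner product of
    v and w make up the inner product of w with itself. *)
Lemma sum_orbit_square (R : comNzRingType) (I Y : finType) (v : {ffun I -> Y} -> R) :
  (\sum_f \sum_(s : {perm I}) v f * v (reindex_ffun s f)) *+ #|{perm I}|
  = \sum_f (\sum_(s : {perm I}) v (reindex_ffun s f)) ^+ 2.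
Proof.
pose w f := \sum_(s : {perm I}) v (reindex_ffun s f).
have rM s t (f : {ffun I -> Y}) :
    reindex_ffun s (reindex_ffun t f) = reindex_ffun (s * t)%g f.
  by apply/ffunP => i; rewrite !ffunE permM.
have r1 (f : {ffun I -> Y}) : reindex_ffun 1%g f = f.
  by apply/ffunP => i; rewrite !ffunE perm1.
have wr t f : w (reindex_ffun t f) = w f.
  rewrite [RHS](reindex_inj (mulIg t)) /w; apply: eq_bigr => s _.
  by rewrite rM.
transitivity (\sum_(t : {perm I}) \sum_f v f * w f).
  by rewrite sumr_const; congr (_ *+ _); apply: eq_bigr => f _; rewrite mulr_sumr.
under [RHS]eq_bigr => f _ do rewrite expr2 mulr_suml.
rewrite [RHS]exchange_big; apply: eq_bigr => t _ /=; rewrite -/(w _).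
rewrite (reindex_onto (reindex_ffun t) (reindex_ffun t^-1%g)) /= => [|f _]; last first.
  by rewrite rM mulgV r1.
by apply: eq_big => [f|f _]; rewrite ?rM ?mulVg ?r1 ?eqxx // wr.
Qed.

Definition blocks_sign (K : nzRingType) (k n : nat) (p : {ffun 'I_k -> 'S_n}) : K :=
  \prod_b (-1) ^+ p b.

Section OmegaConstant.
Variables (K : numDomainType) (k n : nat).
Implicit Types p q : {ffun 'I_k -> 'S_n}.
Local Notation blocks_sign := (@blocks_sign K k n).

(** The places of the matrix entries in the term of the expansion of (\det ^ k)
    that is indexed by p, listed block by block. *)
Definition blocks_entry p : {ffun 'I_(k * n) -> 'I_n * 'I_n} :=
  [ffun a => (p (block a) (place a), place a)].

(** This is Omega^k (\det ^ k): p indexes the terms of Omega^k, q those of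
    \det ^ k, and the number of s for a given pair (p, q) is the derivative of
    the second monomial along the first. *)
Definition omega_const : K :=
  \sum_p blocks_sign p * \sum_(s : 'S_(k * n)) \sum_q blocks_sign q *
     (blocks_entry q == reindex_ffun s (blocks_entry p))%:R.

(** For v the coefficient tensor of \det ^ k, the constant is the inner product of v
    with the sum of its permutations.  By [sum_orbit_square] it is a positive
    rational multiple of a sum of squares.  The square at the diagonal entries e
    is positive: they occur in one term of the expansion only, the one where all
    the permutations are trivial. *)
Lemma omega_const_neq0 : omega_const != 0.
Proof.
pose v (f : {ffun 'I_(k * n) -> 'I_n * 'I_n}) : K :=
  \sum_p blocks_sign p * (blocks_entry p == f)%:R.
pose w f := \sum_(s : 'S_(k * n)) v (reindex_ffun s f).
have sum_delta (F : {ffun 'I_(k * n) -> 'I_n * 'I_n} -> K) g :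
    \sum_f (g == f)%:R * F f = F g.
  rewrite (bigD1 g) //= eqxx mul1r big1 ?addr0 // => f /negPf.
  by rewrite eq_sym => ->; rewrite mul0r.
have -> : omega_const = \sum_f \sum_(s : 'S_(k * n)) v f * v (reindex_ffun s f).
  rewrite exchange_big /= /omega_const.
  under [LHS]eq_bigr do rewrite mulr_sumr.
  rewrite [LHS]exchange_big; apply: eq_bigr => s _ /=.
  under [RHS]eq_bigr do rewrite mulr_suml.
  rewrite [RHS]exchange_big; apply: eq_bigr => p _ /=.
  under [RHS]eq_bigr do rewrite -mulrA.
  by rewrite -mulr_sumr sum_delta.
apply/eqP => c0; have := sum_orbit_square v; rewrite c0 mul0rn => /esym/eqP.
have sgn_real p : blocks_sign p \is Num.real.
  by apply: rpred_prod => b _; rewrite rpredX // rpredN rpred1.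
have v_real f : v f \is Num.real.
  by apply: rpred_sum => p _; rewrite rpredM ?Num.Theory.realn.
have w_real f : w f \is Num.real by apply: rpred_sum.
rewrite Num.Theory.psumr_eq0 => [|f _]; last first.
  exact: Num.Theory.real_exprn_even_ge0 (w_real f) _.
pose e := blocks_entry [ffun => 1%g].
move/allP/(_ e); rewrite mem_index_enum sqrf_eq0 => /(_ isT)/eqP.
have ve s : v (reindex_ffun s e) = (e == reindex_ffun s e)%:R.
  rewrite /v (bigD1 [ffun => 1%g]) //= big1 ?addr0 => [|p].
    by rewrite [blocks_sign _]big1 ?mul1r // => b _; rewrite ffunE odd_perm1.
  case: (blocks_entry p =P _) => [ep|_ _]; last by rewrite mulr0.
  suff -> : p = [ffun=> 1%g] by rewrite eqxx.
  apply/ffunP => b; apply/permP => r; rewrite ffunE perm1.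
  move/ffunP/(_ (position b r)): ep.
  by rewrite !ffunE !perm1 block_position place_position => -[-> <-].
under eq_bigr do rewrite ve; rewrite -natr_sum => /eqP.
rewrite Num.Theory.pnatr_eq0 (bigD1 1%g) //=.
suff -> : e == reindex_ffun 1%g e by [].
by apply/eqP/ffunP => a; rewrite [RHS]ffunE perm1.
Qed.

End OmegaConstant.

(** * Linear spans and generated subalgebras *)

Section SpanClosure.
Variables (K : comNzRingType) (V : lmodType K) (G : set V).

Lemma lin_span0 : lin_span G 0.
Proof. by have [] := lin_span_submod G; rewrite inE. Qed.

Lemma lin_spanP a x y : lin_span G x -> lin_span G y -> lin_span G (a *: x + y).
Proof. have [_ /(_ a x y)] := lin_span_submod G; rewrite !inE; apply. Qed.

Lemma lin_spanD x y : lin_span G x -> lin_span G y -> lin_span G (x + y).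
Proof. by move=> Gx Gy; rewrite -[x]scale1r; apply: lin_spanP. Qed.

Lemma lin_spanZ a x : lin_span G x -> lin_span G (a *: x).
Proof. by move=> Gx; rewrite -[_ *: _]addr0; apply: lin_spanP => //; apply: lin_span0. Qed.

Lemma lin_span_sum (I : Type) (r : seq I) (P : pred I) (F : I -> V) :
  (forall i, P i -> lin_span G (F i)) -> lin_span G (\sum_(i <- r | P i) F i).
Proof.
move=> GF; elim/big_rec: _ => [|i x /GF Gi Gx]; first exact: lin_span0.
exact: lin_spanD.
Qed.

End SpanClosure.

Lemma lin_span_map (K : comNzRingType) (V V' : lmodType K) (f : {linear V -> V'})
    (G : set V) (G' : set V') :
  (forall x, G x -> lin_span G' (f x)) ->
  forall x, lin_span G x -> lin_span G' (f x).
Proof.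
move=> fG; apply: (lin_span_ind (P := fun x => lin_span G' (f x))) => [//||a x y].
  by rewrite linear0; apply: lin_span0.
by rewrite linearP; apply: lin_spanP.
Qed.

Lemma lin_span_sub (K : comNzRingType) (V : lmodType K) (G G' : set V) :
  (forall x, G x -> lin_span G' x) -> forall x, lin_span G x -> lin_span G' x.
Proof. exact: (lin_span_map (f := idfun)). Qed.

Lemma gen_subalg_closed (K : comNzRingType) (A : algType K) (G : set A) :
  GRing.subalg_closed (mem (gen_subalg G)).
Proof.
split=> [|a x y|x y].
- by rewrite inE => S [[S1 _ _] _]; rewrite inE in S1.
- rewrite !inE => Gx Gy S [cS GS].
  have Sx := Gx S (conj cS GS); have Sy := Gy S (conj cS GS).
  by have [_ /(_ a x y)] := cS; rewrite !inE => + _; apply.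
- rewrite !inE => Gx Gy S [cS GS].
  have Sx := Gx S (conj cS GS); have Sy := Gy S (conj cS GS).
  by have [_ _ /(_ x y)] := cS; rewrite !inE; apply.
Qed.

Section GenSubalg.
Variables (K : comNzRingType) (A : algType K) (G : set A).

Lemma gen_subalg_gen x : G x -> gen_subalg G x.
Proof. exact: sub_gen_smallest. Qed.

Lemma gen_subalgM x y : gen_subalg G x -> gen_subalg G y -> gen_subalg G (x * y).
Proof. by have [_ _ /(_ x y)] := gen_subalg_closed G; rewrite !inE. Qed.

Lemma gen_subalg_prod (I : Type) (r : seq I) (F : I -> A) :
  (forall i, gen_subalg G (F i)) -> gen_subalg G (\prod_(i <- r) F i).
Proof.
move=> GF; elim/big_rec: _ => [|i x _ Gx]; last exact: gen_subalgM.
by have [] := gen_subalg_closed G; rewrite inE.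
Qed.

Lemma lin_span_gen_subalg (H : set A) :
  (forall x, H x -> gen_subalg G x) -> forall x, lin_span H x -> gen_subalg G x.
Proof.
have [G1 GL _] := gen_subalg_closed G; rewrite inE in G1.
have GP a x y : gen_subalg G x -> gen_subalg G y -> gen_subalg G (a *: x + y).
  by have := GL a x y; rewrite !inE.
move=> HG; apply: lin_span_ind => //.
by rewrite -(subrr 1) addrC -scaleN1r; apply: GP.
Qed.

End GenSubalg.

(** * Words and their degree *)

Section Words.
Variables (K : comNzRingType) (W : lmodType K).
Implicit Types (u v : seq W) (s : Sinf).

Definition letter (w : W) : tbar W := tb [:: w] 1%g.

Fact letter_linear : linear letter.
Proof. by move=> a x y; rewrite /letter (tb_linear [::]). Qed.
HB.instance Definition _ := GRing.isLinear.Build K W (tbar W) _ letter letter_linear.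

Lemma tb_catS u v s : tb (u ++ v) s = tb u 1%g * tb v s.
Proof. by rewrite tbM iter_alpha1 mul1g. Qed.

(** Words are products of letters, so that the distributive law of the ring
    expands them multilinearly. *)
Lemma tb_prod_letters u s : tb u s = (\prod_(w <- u) letter w) * tbS W s.
Proof.
elim: u => [|w u IH]; first by rewrite big_nil mul1r.
by rewrite -cat1s tb_catS IH big_cons mulrA.
Qed.

Lemma tb_prod_ord p (v : 'I_p -> W) s :
  tb [seq v i | i <- enum 'I_p] s = (\prod_i letter (v i)) * tbS W s.
Proof. by rewrite tb_prod_letters big_map enumT [index_enum _]unlock. Qed.

Lemma prod_letters p (v : 'I_p -> W) :
  \prod_i letter (v i) = tb [seq v i | i <- enum 'I_p] 1%g.
Proof. by rewrite tb_prod_ord [tbS _ _]tb1 mulr1. Qed.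

Lemma tbS_tb s v : tbS W s * tb v 1%g = tb v 1%g * tbS W (iter (size v) alpha s).
Proof. by rewrite !tbM /= !mulg1 mul1g cats0. Qed.

(** The component of degree p of Tbar(W) is spanned by [words p], that of T(W)
    by [plain_words p]. *)
Definition words p : set (tbar W) := [set x | exists u s, size u = p /\ x = tb u s].
Definition plain_words p : set (tbar W) :=
  [set x | exists2 u, size u = p & x = tb u 1%g].

Definition degree_part p : tbar W -> tbar W :=
  tbar_lift (fun u s => if size u == p then tb u s else 0).

Fact degree_part_rel1 p u v a x y s :
  let f u s := if size u == p then tb u s else 0 : tbar W in
  f (u ++ (a *: x + y) :: v) s = a *: f (u ++ x :: v) s + f (u ++ y :: v) s.
Proof.
rewrite /= !size_cat /=; case: eqP => _; first exact: tb_linear.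
by rewrite scaler0 addr0.
Qed.
Fact degree_part_rel2 p u (t : Sinf) s : Sfin (size u) t ->
  let f u s := if size u == p then tb u s else 0 : tbar W in
  f (word_perm u t) s = f u (t * s)%g.
Proof. by move=> tu; rewrite /= size_word_perm tb_perm. Qed.

Lemma degree_part_tb p u s :
  degree_part p (tb u s) = if size u == p then tb u s else 0.
Proof. exact: (tbar_lift_tb (@degree_part_rel1 p) (@degree_part_rel2 p)). Qed.

Fact degree_part_linear p : linear (degree_part p).
Proof. exact: (tbar_lift_linear (@degree_part_rel1 p) (@degree_part_rel2 p)). Qed.
HB.instance Definition _ p :=
  GRing.isLinear.Build K (tbar W) (tbar W) _ (degree_part p) (degree_part_linear p).

Lemma degree_part_words p x : lin_span (words p) (degree_part p x).
Proof.
elim/tb_ind: x => [|c u s x IH]; first by rewrite linear0; apply: lin_span0.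
rewrite linearP /= degree_part_tb; apply: lin_spanP => //.
by case: eqP => [<-|_]; [apply: lin_span_gen; exists u, s | apply: lin_span0].
Qed.

Lemma sum_degree_parts x : exists N, x = \sum_(p < N) degree_part p x.
Proof.
suff [N xN] : exists N, forall M, (N <= M)%N -> x = \sum_(p < M) degree_part p x.
  by exists N; apply: xN.
elim/tb_ind: x => [|c u s x [N IH]].
  by exists 0%N => M _; rewrite big1 // => p _; rewrite linear0.
exists (maxn N (size u).+1) => M; rewrite geq_max => /andP[NM uM].
under eq_bigr do rewrite linearP /= degree_part_tb.
rewrite big_split /= -IH // -scaler_sumr (bigD1 (Ordinal uM)) //= eqxx.
rewrite big1 ?addr0 // => p /negPf; rewrite -val_eqE /= eq_sym => -> //.
Qed.

Lemma degree_part_tensor p x :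
  tensor_alg W x -> lin_span (plain_words p) (degree_part p x).
Proof.
apply: lin_span_map => _ [u _ <-] /=; rewrite degree_part_tb; case: eqP => [up|_].
  by apply: lin_span_gen; exists u.
exact: lin_span0.
Qed.

Lemma lin_spanM (G H L : set (tbar W)) :
  (forall x y, G x -> H y -> lin_span L (x * y)) ->
  forall x y, lin_span G x -> lin_span H y -> lin_span L (x * y).
Proof.
move=> GHL x y Gx; move: y; apply: lin_span_ind => [y Hy||a y z yL zL].
- move: x Gx; apply: lin_span_ind => [x Gx||a x z xL zL]; first exact: GHL.
  + by rewrite mul0r; apply: lin_span0.
  + by rewrite mulrDl -scalerAl; apply: lin_spanP.
- by rewrite mulr0; apply: lin_span0.
- by rewrite mulrDr -scalerAr; apply: lin_spanP.
Qed.

End Words.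
Arguments words {K} W p.
Arguments plain_words {K} W p.

(** * Permuting the letters of a word *)

Section PermWord.
Variable p : nat.

(** Lists of letters are read from left to right, the points of S_infinity
    number them from right to left; hence the two occurrences of [rev_ord]. *)
Definition sinf_fun (t : 'S_p) (k : nat) : nat :=
  if insub k is Some i then rev_ord (t (rev_ord i)) else k.

Definition sinf_fsfun (t : 'S_p) : {fsfun nat -> nat} :=
  [fsfun k in [fset i | i in iota 0 p]%fset => sinf_fun t k].

Lemma sinf_fsfunE t k : sinf_fsfun t k = sinf_fun t k.
Proof.
rewrite fsfunE; case: ifPn => //; rewrite in_fset mem_iota /= add0n => kp.
by rewrite /sinf_fun insubF //; apply/negbTE.
Qed.

Fact sinf_subproof t : fsinjectiveb (sinf_fsfun t).
Proof.
apply/fsinjectiveP => k l; rewrite !sinf_fsfunE /sinf_fun.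
case: insubP => [i _ <-|kp]; case: insubP => [j _ <-|lp] //.
- by move=> /val_inj/rev_ord_inj/perm_inj/rev_ord_inj ->.
- by move=> il; move: lp; rewrite -il ltn_ord.
- by move=> kj; move: kp; rewrite kj ltn_ord.
Qed.
Definition sinf_perm (t : 'S_p) : Sinf := Sub _ (sinf_subproof t).

Lemma sinf_permE t k : sinf_perm t k = sinf_fun t k.
Proof. exact: sinf_fsfunE. Qed.

Lemma sinf_perm_fin t : Sfin p (sinf_perm t).
Proof. by move=> k pk; rewrite sinf_permE /sinf_fun insubF // ltnNge pk. Qed.

Lemma word_perm_enum t : word_perm (enum 'I_p) (sinf_perm t) = map t (enum 'I_p).
Proof.
have [p0|p0] := posnP p.
  have enum0 : enum 'I_p = [::] by apply: size0nil; rewrite size_enum_ord.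
  by rewrite enum0.
pose x0 := Ordinal p0.
apply: (@rev_nth_ext _ x0 (word_perm _ _) (map t _)) => [|k].
  by rewrite size_word_perm [RHS]size_map.
rewrite size_word_perm size_enum_ord => kp.
rewrite nth_word_perm; last by rewrite size_enum_ord; apply: sinf_perm_fin.
have nth_rev_enum (i : 'I_p) : nth x0 (rev (enum 'I_p)) i = rev_ord i.
  by rewrite nth_rev size_enum_ord // -[(p - _)%N]/(val (rev_ord i)) nth_ord_enum.
rewrite sinf_permE /sinf_fun insubT nth_rev_enum rev_ordK -map_rev.
rewrite (nth_map x0) ?size_rev ?size_enum_ord //.
by rewrite (nth_rev_enum (Ordinal kp)).
Qed.

(** The element of S_p on the right depends on t only, so that this identity can
    be summed over v. *)
Lemma prod_letters_perm (K : comNzRingType) (W : lmodType K) (t : 'S_p) (v : 'I_p -> W) :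
  \prod_i letter (v (t i)) = (\prod_i letter (v i)) * tbS W (sinf_perm t).
Proof.
rewrite !prod_letters tb_mulS; last by rewrite size_map size_enum_ord; apply: sinf_perm_fin.
rewrite -map_word_perm; last by rewrite size_enum_ord; apply: sinf_perm_fin.
by rewrite word_perm_enum -[in RHS]map_comp.
Qed.

End PermWord.

(** * Polarizing the action and the determinant *)

Lemma distr_partial_values (A : nzRingType) p (S : {set 'I_p})
    (F : 'I_p -> option 'I_p -> A) :
  \prod_i (F i None + \sum_(a in S) F i (Some a)) =
  \sum_(f : {ffun 'I_p -> option 'I_p} | partial_values f \subset S) \prod_i F i (f i).
Proof.
pose Q : pred (option 'I_p) := fun o => if o is Some a then a \in S else true.
transitivity (\prod_i \sum_(o | Q o) F i o).
  apply: eq_bigr => i _; rewrite (bigD1 None) //=; congr (_ + _).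
  rewrite (reindex_omap (op := +%R) Some id) /= => [|[a|]] //.
  by apply: eq_bigl => a; rewrite eqxx !andbT.
rewrite bigA_distr_big; apply: eq_bigl => f.
apply/ffun_onP/fintype.subsetP => [fQ a|fS i].
  by rewrite inE => /codomP[i fi]; have := fQ i; rewrite -fi.
case fi: (f i) => [a|] //; apply: fS.
by rewrite inE; apply/codomP; exists i.
Qed.

Lemma polarization_prod (K : comNzRingType) (A : algType K) p
    (F : 'I_p -> option 'I_p -> A) :
  \sum_(S : {set 'I_p}) (-1) ^+ #|~: S| *:
      \prod_i (F i None + \sum_(a in S) F i (Some a))
  = \sum_(s : 'S_p) \prod_i F i (Some (s i)).
Proof.
under eq_bigr do rewrite distr_partial_values.
rewrite (polarization (fun f => \prod_i F i (f i))).
by apply: eq_bigr => s _; apply: eq_bigr => i _; rewrite ffunE.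
Qed.

Lemma det_exp_blocks (K : comNzRingType) k n (g : 'M[K]_n) :
  \det g ^+ k = \sum_(q : {ffun 'I_k -> 'S_n})
     blocks_sign K q * \prod_(a < k * n) g (q (block a) (place a)) (place a).
Proof.
rewrite -det_tr /determinant.
transitivity (\prod_(b < k) \sum_(s : 'S_n) (-1) ^+ s * \prod_r g (s r) r).
  rewrite prodr_const card_ord; congr (_ ^+ _); apply: eq_bigr => s _.
  by congr (_ * _); apply: eq_bigr => r _; rewrite mxE.
rewrite bigA_distr_bigA; apply: eq_bigr => q _; rewrite big_split /=.
congr (_ * _); rewrite prod_blocks; apply: eq_bigr => b _; apply: eq_bigr => r _.
by rewrite block_position place_position.
Qed.

Lemma polarization_det (K : comNzRingType) k n (G : 'I_(k * n) -> 'M[K]_n) (h : 'M[K]_n) :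
  \sum_(S : {set 'I_(k * n)}) (-1) ^+ #|~: S| * \det (h + \sum_(a in S) G a) ^+ k
  = \sum_(s : 'S_(k * n)) \sum_(q : {ffun 'I_k -> 'S_n}) blocks_sign K q *
      \prod_a G (s a) (q (block a) (place a)) (place a).
Proof.
under eq_bigr do rewrite det_exp_blocks mulr_sumr.
rewrite exchange_big [RHS]exchange_big; apply: eq_bigr => q _ /=.
pose F (a : 'I_(k * n)) o : K^o :=
  (if o is Some c then G c else h) (q (block a) (place a)) (place a).
transitivity (blocks_sign K q * \sum_(s : 'S_(k * n)) (\prod_a F a (Some (s a)) : K));
  last by rewrite mulr_sumr.
have /= <- := polarization_prod F; rewrite mulr_sumr; apply: eq_bigr => S _.
rewrite mulrCA; congr (_ * (_ * _)).
by apply: eq_bigr => a _; rewrite !mxE summxE.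
Qed.

Section Action.
Variables (K : comNzRingType) (n n' : nat).
Notation W := 'M[K]_(n, n').
Implicit Types (g h : 'M[K]_n) (x y : tbar W).

HB.instance Definition _ g := GRing.Linear.copy (@gl_act K n n' g)
  (tbar_map (mulmx g : {linear W -> W})).
HB.instance Definition _ g := GRing.RMorphism.copy (@gl_act K n n' g)
  (tbar_map (mulmx g : {linear W -> W})).

Lemma gl_act_tb g (u : seq W) s : gl_act g (tb u s) = tb [seq g *m v | v <- u] s.
Proof. exact: tbar_map_tb. Qed.

Lemma gl_act_tbS g s : gl_act g (tbS W s) = tbS W s.
Proof. exact: gl_act_tb. Qed.

Lemma gl_act_letter g (v : W) : gl_act g (letter v) = letter (g *m v).
Proof. exact: gl_act_tb. Qed.

Lemma gl_act_mul g h x : gl_act (g *m h) x = gl_act g (gl_act h x).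
Proof.
elim/tb_ind: x => [|c u s x IH]; first by rewrite !linear0.
rewrite !linearP /= IH !gl_act_tb -map_comp; congr (_ *: tb _ s + _).
by apply: eq_map => v /=; rewrite mulmxA.
Qed.

Lemma gl_act_degree_part g p x :
  gl_act g (degree_part p x) = degree_part p (gl_act g x).
Proof.
elim/tb_ind: x => [|c u s x IH]; first by rewrite !linear0.
rewrite !linearP /= IH gl_act_tb !degree_part_tb size_map; congr (_ *: _ + _).
by case: eqP => _; rewrite ?gl_act_tb ?linear0.
Qed.

Lemma gl_act_scalar c p x : lin_span (words W p) x ->
  gl_act c%:M x = c ^+ p *: x.
Proof.
move: x; apply: lin_span_ind => [x [u [s [<- ->]]]||a x y xE yE].
- rewrite gl_act_tb !tb_prod_letters scalerAl; congr (_ * _).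
  elim: u => [|w u IH]; first by rewrite !big_nil scale1r.
  rewrite /= !big_cons IH mul_scalar_mx linearZ /= exprS.
  by rewrite -!(scalerAl, scalerAr) scalerA.
- by rewrite linear0 scaler0.
- by rewrite linearP /= xE yE scalerDr !scalerA mulrC.
Qed.

(** The polarization of g |-> g v_1 ... v_p is multilinear in the p matrices:
    each of them acts on one letter, in all possible orders. *)
Lemma polarization_act p (G : 'I_p -> 'M[K]_n) h (v : 'I_p -> W) s :
  \sum_(S : {set 'I_p}) (-1) ^+ #|~: S| *:
    gl_act (h + \sum_(a in S) G a) (tb [seq v i | i <- enum 'I_p] s)
  = (\sum_(t : 'S_p) \prod_i letter (G (t i) *m v i)) * tbS W s.
Proof.
pose F i o : tbar W := letter ((if o is Some c then G c else h) *m v i).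
rewrite -(polarization_prod F) mulr_suml; apply: eq_bigr => S _.
rewrite tb_prod_ord rmorphM /= gl_act_tbS -scalerAl rmorph_prod.
congr (_ *: (_ * _)); apply: eq_bigr => i _.
by rewrite /= gl_act_letter mulmxDl mulmx_suml linearD linear_sum.
Qed.

End Action.

(** * Determinants with values in words *)

Section DetTensor.
Variables (K : comNzRingType) (n n' : nat).
Notation W := 'M[K]_(n, n').
Implicit Types (y : 'I_n -> 'rV[K]_n') (J : 'I_n -> 'I_n').

(** The determinant in T(W) of the matrix with entries e_i (x) y_r; these are the
    column vector e_i times the row vector y_r. *)
Definition det_tensor y : tbar W :=
  \sum_(s : 'S_n) (-1) ^+ s *: \prod_r letter (delta_mx (s r) (0 : 'I_1) *m y r).

Definition det_basis J : tbar W := det_tensor (fun r => delta_mx 0 (J r)).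

Lemma det_basisE J :
  det_basis J = \sum_(s : 'S_n) (-1) ^+ s *: \prod_r letter (delta_mx (s r) (J r) : W).
Proof.
apply: eq_bigr => s _; congr (_ *: _); apply: eq_bigr => r _.
by rewrite mul_delta_mx.
Qed.

Lemma det_tensor_basis y :
  det_tensor y = \sum_(J : {ffun 'I_n -> 'I_n'}) (\prod_r y r 0 (J r)) *: det_basis J.
Proof.
rewrite /det_tensor.
under [RHS]eq_bigr do rewrite det_basisE scaler_sumr.
rewrite [RHS]exchange_big; apply: eq_bigr => s _ /=.
under [RHS]eq_bigr => J _ do rewrite scalerA mulrC -scalerA.
rewrite -scaler_sumr; congr (_ *: _).
pose F r j := y r 0 j *: letter (delta_mx (s r) j : W).
transitivity (\prod_r \sum_j F r j).
  apply: eq_bigr => r _; rewrite [y r in LHS]row_sum_delta mulmx_sumr linear_sum.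
  by apply: eq_bigr => j _; rewrite /= -scalemxAr linearZ /= mul_delta_mx.
by rewrite bigA_distr_bigA; apply: eq_bigr => J _; rewrite scaler_prod.
Qed.

(** Permuting the rows y_r can be absorbed in the permutation of the e_i, at the
    cost of a sign, and of the permutation of the letters that puts them back in
    order. *)
Lemma det_tensor_perm y (t : 'S_n) :
  det_tensor (fun r => y (t r)) = (-1) ^+ t *: (det_tensor y * tbS W (sinf_perm t)).
Proof.
rewrite /det_tensor mulr_suml scaler_sumr (reindex_inj (mulgI t)) /=.
apply: eq_bigr => s _; rewrite odd_permM signr_addb -scalerAl scalerA.
congr (_ *: _).
rewrite -(prod_letters_perm t (fun r => delta_mx (s r) (0 : 'I_1) *m y r)).
by apply: eq_bigr => r _; rewrite permM.
Qed.

(** As in the proof that the determinant is multiplicative: after expanding g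
    in each factor, the coefficient of a word with row labels f is the
    determinant of the rows f of g; it vanishes unless f is a permutation. *)
Lemma gl_act_det_basis g J : gl_act g (det_basis J) = \det g *: det_basis J.
Proof.
rewrite det_basisE linear_sum scaler_sumr.
pose L (f : 'I_n -> 'I_n) := \prod_r letter (delta_mx (f r) (J r) : W).
have actL (s : 'S_n) : gl_act g (\prod_r letter (delta_mx (s r) (J r) : W)) =
    \sum_(f : {ffun 'I_n -> 'I_n}) (\prod_r g (f r) (s r)) *: L f.
  rewrite rmorph_prod.
  transitivity (\prod_r \sum_l g l (s r) *: letter (delta_mx l (J r) : W)).
    apply: eq_bigr => r _; rewrite /= gl_act_letter.
    rewrite -[delta_mx _ _](mul_delta_mx (0 : 'I_1)) mulmxA -colE.
    rewrite [col _ _ in LHS]matrix_sum_delta.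
    rewrite mulmx_suml linear_sum; apply: eq_bigr => l _ /=.
    by rewrite big_ord1 -scalemxAl linearZ /= mul_delta_mx mxE.
  by rewrite bigA_distr_bigA; apply: eq_bigr => f _; rewrite scaler_prod.
under eq_bigr => s _ do rewrite linearZ /= actL scaler_sumr.
rewrite exchange_big /=.
transitivity (\sum_(f : {ffun 'I_n -> 'I_n}) \det (\matrix_(r, c) g (f r) c) *: L f).
  apply: eq_bigr => f _; rewrite /determinant scaler_suml; apply: eq_bigr => s _.
  by rewrite scalerA; congr ((_ * _) *: _); apply: eq_bigr => r _; rewrite mxE.
pose h (s : 'S_n) : {ffun 'I_n -> 'I_n} := [ffun r => s r].
have h_inj : injective h.
  by move=> s t /ffunP st; apply/permP => r; have := st r; rewrite !ffunE.
transitivity (\sum_(f in [set h s | s in predT]%SET) \det (\matrix_(r, c) g (f r) c) *: L f).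
  rewrite [RHS]big_mkcond /=; apply: eq_bigr => f _.
  case: ifPn => // /imsetP fh.
  have /injectivePn[r [c rc frc]] : ~~ injectiveb f.
    apply/negP => /injectiveP f_inj; apply: fh; exists (perm f_inj) => //.
    by apply/ffunP => r; rewrite ffunE permE.
  by rewrite (determinant_alternate rc) ?scale0r // => i; rewrite !mxE frc.
rewrite big_imset /=; last by move=> s t _ _ /h_inj.
apply: eq_bigr => s _; rewrite scalerA mulrC.
have -> : \matrix_(r, c) g (h s r) c = row_perm s g.
  by apply/matrixP => r c; rewrite !mxE ffunE.
rewrite row_permE det_mulmx det_perm; congr (_ *: _).
by apply: eq_bigr => r _; rewrite ffunE.
Qed.

Definition det_gen (J : n.-tuple 'I_n') : tbar W :=
  column_det (submx_seq (Ymx K n n') (rev_tuple (ord_tuple n)) (rev_tuple J)).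

Lemma tnth_rev_ord_tuple (i : 'I_n) : tnth (rev_tuple (ord_tuple n)) i = rev_ord i.
Proof.
apply: val_inj; rewrite (tnth_nth i) /= nth_rev ?size_enum_ord //.
by rewrite -[(n - _)%N]/(val (rev_ord i)) nth_ord_enum.
Qed.

(** The reversal of the rows is absorbed in a sign.  The columns stay reversed,
    since they are attached to the positions of the letters. *)
Lemma det_genE (J : n.-tuple 'I_n') :
  det_gen J = (-1) ^+ perm (@rev_ord_inj n) *: det_basis (tnth (rev_tuple J)).
Proof.
rewrite det_basisE scaler_sumr /det_gen /column_det.
rewrite (reindex_inj (mulIg (perm (@rev_ord_inj n)))) /=.
apply: eq_bigr => s _; rewrite scalerA -signr_addb addbC -odd_permM.
rewrite mulr_sign -scaler_sign; congr (_ *: _); apply: eq_bigr => r _.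
by rewrite !mxE tnth_rev_ord_tuple permM permE rev_ordK.
Qed.

(** The list of columns is reversed because the generators carry the columns in
    decreasing order. *)
Lemma sorted_columns (J : 'I_n -> 'I_n') : exists J0 : n.-tuple 'I_n', exists t : 'S_n,
  sorted leq (map val J0) /\ J =1 (fun r => tnth (rev_tuple J0) (t r)).
Proof.
pose leqI := relpre (val : 'I_n' -> nat) leq.
pose J0 := sort_tuple leqI [tuple J i | i < n]; exists J0.
have /tuple_permP[t Jt] : perm_eq [tuple J i | i < n] (rev_tuple J0).
  by rewrite /= perm_sym perm_rev perm_sort.
exists t; split; first by rewrite sorted_map sort_sorted // => i j; apply: leq_total.
by move=> r; have /(congr1 (fun u => tnth u r)) := val_inj Jt; rewrite !tnth_mktuple.
Qed.

(** Keeping one permutation next to each determinant makes the span of these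
    elements contain the determinants with arbitrary columns. *)
Definition perm_dets : set (tbar W) :=
  [set x | exists A s, [/\ det_gens K n n' A, Sfin n s & x = A * tbS W s]].

Lemma det_basis_span J : lin_span perm_dets (det_basis J).
Proof.
have [J0 [t [J0_sorted J0E]]] := sorted_columns J.
have -> : det_basis J = det_tensor (fun r => delta_mx 0 (tnth (rev_tuple J0) (t r))).
  by rewrite !det_basisE; apply: eq_bigr => s _; congr (_ *: _);
    apply: eq_bigr => r _; rewrite mul_delta_mx J0E.
rewrite (det_tensor_perm (fun r => delta_mx 0 (tnth (rev_tuple J0) r))).
apply: lin_spanZ.
rewrite -[det_tensor _]/(det_basis (tnth (rev_tuple J0))).
have -> : det_basis (tnth (rev_tuple J0)) =
    (-1) ^+ perm (@rev_ord_inj n) *: det_gen J0.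
  by rewrite det_genE scalerA -expr2 sqrr_sign scale1r.
rewrite -scalerAl; apply: lin_spanZ; apply: lin_span_gen.
by exists (det_gen J0), (sinf_perm t); split=> //; [exists J0|apply: sinf_perm_fin].
Qed.

Lemma det_tensor_span y : lin_span perm_dets (det_tensor y).
Proof.
by rewrite det_tensor_basis; apply: lin_span_sum => J _; apply: lin_spanZ; apply: det_basis_span.
Qed.

Lemma det_gens_words A : det_gens K n n' A -> lin_span (plain_words W n) A.
Proof.
case=> J _ ->; rewrite -/(det_gen J) det_genE det_basisE; apply: lin_spanZ; apply: lin_span_sum.
move=> s _; apply: lin_spanZ; apply: lin_span_gen; rewrite prod_letters.
exists [seq delta_mx (s r) (tnth (rev_tuple J) r) | r <- enum 'I_n]; last by [].
by rewrite size_map size_enum_ord.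
Qed.

Lemma gl_act_det_gens g A : det_gens K n n' A -> gl_act g A = \det g *: A.
Proof.
case=> J _ ->; rewrite -/(det_gen J) det_genE linearZ /= gl_act_det_basis.
by rewrite !scalerA mulrC.
Qed.

(** Permutations thus move to the right of any determinant, where they can be
    collected. *)
Lemma tbS_plain_words p s x : lin_span (plain_words W p) x ->
  tbS W s * x = x * tbS W (iter p alpha s).
Proof.
move: x; apply: lin_span_ind => [_ [u <- ->]||a x y xE yE].
- exact: tbS_tb.
- by rewrite mulr0 mul0r.
- by rewrite mulrDr mulrDl -scalerAr -scalerAl xE yE.
Qed.

Definition det_products k : set (tbar W) :=
  [set x | exists (A : 'I_k -> tbar W) (s : Sinf),
     [/\ forall a, det_gens K n n' (A a), Sfin (k * n) s
       & x = (\prod_(a < k) A a) * tbS W s]].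

Lemma Sfin1 p : Sfin p 1%g.
Proof. by move=> k _; rewrite Sinf1. Qed.

Lemma SfinM p s t : Sfin p s -> Sfin p t -> Sfin p (s * t)%g.
Proof. by move=> sp tp k pk; rewrite SinfM tp // sp. Qed.

Lemma det_products_tbS k s x : Sfin (k * n) s ->
  lin_span (det_products k) x -> lin_span (det_products k) (x * tbS W s).
Proof.
move=> sk; move: x; apply: lin_span_ind => [_ [A [t [IA tk ->]]]||a x y xE yE].
- apply: lin_span_gen; exists A, (t * s)%g; split=> //; first exact: SfinM.
  by rewrite tbSM mulrA.
- by rewrite mul0r; apply: lin_span0.
- by rewrite mulrDl -scalerAl; apply: lin_spanP.
Qed.

Lemma det_products_prod k (D : 'I_k -> tbar W) :
  (forall b, lin_span perm_dets (D b)) ->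
  lin_span (det_products k) (\prod_b D b).
Proof.
elim: k D => [|k IH] D DI.
  rewrite big_ord0; apply: lin_span_gen; exists (fun=> 0), 1%g.
  split=> [[]//||]; first exact: Sfin1.
  by rewrite big_ord0 mul1r.
rewrite big_ord_recr /=; apply: lin_spanM (IH _ (fun b => DI _)) (DI _).
move=> _ _ [A [s [IA sk ->]]] [B [t [IB tn ->]]]; apply: lin_span_gen.
pose C (a : 'I_k.+1) := if insub (val a) is Some b then A b else B.
exists C, (iter n alpha s * t)%g; split=> [a||].
- by rewrite /C; case: insub => [b|//]; apply: IA.
- by rewrite mulSnr; apply: SfinM; [apply: Sfin_iter_alpha | apply: Sfin_catl].
rewrite tbSM big_ord_recr /= -mulrA [tbS W s * _]mulrA.
rewrite (tbS_plain_words _ (det_gens_words IB)) !mulrA; congr (_ * _ * _ * _).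
  by apply: eq_bigr => b _; rewrite /C -[\val (widen_ord _ _)]/(val b) valK.
by rewrite /C insubF //; apply: ltnn.
Qed.

Lemma det_products_words k x :
  det_products k x -> lin_span (plain_words W (k * n)) x.
Proof.
have wordsS p s (y : tbar W) : Sfin p s -> lin_span (plain_words W p) y ->
    lin_span (plain_words W p) (y * tbS W s).
  move=> sp; move: y; apply: lin_span_ind => [_ [u up ->]||a z z' zE zE'].
  - rewrite tb_mulS ?up //; apply: lin_span_gen; exists (word_perm u s) => //.
    by rewrite size_word_perm.
  - by rewrite mul0r; apply: lin_span0.
  - by rewrite mulrDl -scalerAl; apply: lin_spanP.
case=> [A [s [IA sk ->]]]; apply: wordsS => // {s sk}.
elim: k A IA => [|k IH] A IA.
  by rewrite big_ord0; apply: lin_span_gen; exists [::].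
rewrite big_ord_recr /= mulSnr.
apply: lin_spanM (IH _ (fun b => IA _)) (det_gens_words (IA _)).
move=> _ _ [u up ->] [v vp ->]; rewrite -tb_catS; apply: lin_span_gen.
by exists (u ++ v); rewrite ?size_cat ?up ?vp.
Qed.

End DetTensor.

(** * The Omega process *)

Section Omega.
Variables (K : comNzRingType) (n n' k : nat).
Notation W := 'M[K]_(n, n').
Implicit Types p q : {ffun 'I_k -> 'S_n}.

Definition omega_mx p (a : 'I_(k * n)) : 'M[K]_n :=
  delta_mx (p (block a) (place a)) (place a).

(** The operator Omega^k, with a shift t.  By definition it is a combination of
    actions of matrices, which makes its value on invariants accessible; the
    values do not depend on t, by [polarization_act]. *)
Definition omega (t : K) (x : tbar W) : tbar W :=
  \sum_p blocks_sign K p *: \sum_(S : {set 'I_(k * n)}) (-1) ^+ #|~: S| *: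
    gl_act (t%:M + \sum_(a in S) omega_mx p a) x.

Fact omega_linear t : linear (omega t).
Proof.
move=> c x y; rewrite /omega scaler_sumr -big_split; apply: eq_bigr => p _ /=.
rewrite !scaler_sumr -big_split; apply: eq_bigr => S _ /=.
rewrite linearP /= !scalerDr !scalerA; congr (_ *: _ + _).
by rewrite -[RHS]mulrA [RHS]mulrC.
Qed.
HB.instance Definition _ t :=
  GRing.isLinear.Build K (tbar W) (tbar W) _ (omega t) (omega_linear t).

Lemma omega_mx_mul p a (v : W) :
  omega_mx p a *m v = delta_mx (p (block a) (place a)) (0 : 'I_1) *m row (place a) v.
Proof. by rewrite rowE mulmxA mul_delta_mx. Qed.

(** The elementary matrix E_(p_b r, r) keeps the row r of a letter and moves it to
    the row p_b r.  So the sum over p is a product over the blocks b of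
    alternating sums over the n! values of p_b. *)
Lemma sum_blocks_det (v : 'I_(k * n) -> W) :
  \sum_p blocks_sign K p *: \prod_a letter (omega_mx p a *m v a) =
  \prod_b det_tensor (fun r => row r (v (position b r))).
Proof.
rewrite /det_tensor bigA_distr_bigA; apply: eq_bigr => p _.
rewrite prod_blocks scaler_prod; congr (_ *: _); apply: eq_bigr => b _.
apply: eq_bigr => r _.
by rewrite omega_mx_mul block_position place_position.
Qed.

Lemma omega_word t (v : 'I_(k * n) -> W) s :
  exists2 y, lin_span (@det_products K n n' k) y &
    omega t (tb [seq v i | i <- enum 'I_(k * n)] s) = y * tbS W s.
Proof.
exists (\sum_(c : 'S_(k * n)) \sum_p blocks_sign K p *:
          \prod_i letter (omega_mx p (c i) *m v i)).
  (* Reorder the letters by c, so that the a-th matrix meets the a-th position. *)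
  apply: lin_span_sum => c _.
  under eq_bigr => p _.
    rewrite (eq_bigr (fun i => letter (omega_mx p (c i) *m v (c^-1 (c i))%g))); last first.
      by move=> i _; rewrite permK.
    rewrite (prod_letters_perm c (fun a => omega_mx p a *m v (c^-1%g a))) scalerAl.
    over.
  rewrite -mulr_suml sum_blocks_det; apply: det_products_tbS; first exact: sinf_perm_fin.
  by apply: det_products_prod => b; apply: det_tensor_span.
rewrite /omega exchange_big /= mulr_suml; apply: eq_bigr => p _.
by rewrite polarization_act -scaler_sumr -scalerAl.
Qed.

Lemma omega_tb t u s : size u = (k * n)%N ->
  exists2 y, lin_span (@det_products K n n' k) y & omega t (tb u s) = y * tbS W s.
Proof.
move=> un; have := omega_word t (tnth (tcast un (in_tuple u))) s.
by rewrite map_tnth_enum val_tcast.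
Qed.

Lemma omega_plain_words t x : lin_span (plain_words W (k * n)) x ->
  lin_span (@det_products K n n' k) (omega t x).
Proof.
apply: lin_span_map => _ [u un ->] /=; have [y yD ->] := omega_tb t 1%g un.
by rewrite [tbS _ _]tb1 mulr1.
Qed.

Lemma omega_words t x : lin_span (words W (k * n)) x ->
  gen_subalg (det_gens K n n' `|` range (tbS W)) (omega t x).
Proof.
move=> xk; set G := gen_subalg _.
have tbS_gen s : G (tbS W s) by apply: gen_subalg_gen; right; exists s.
apply: (@lin_span_gen_subalg _ _ _ G) => //; move: x xk.
apply: lin_span_map => _ [u [s [un ->]]] /=; have [y yD ->] := omega_tb t s un.
apply: lin_span_gen; apply: gen_subalgM; last exact: tbS_gen.
apply: lin_span_gen_subalg yD => _ [A [c [IA _ ->]]].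
apply: gen_subalgM; last exact: tbS_gen.
by apply: gen_subalg_prod => a; apply: gen_subalg_gen; left; apply: IA.
Qed.

End Omega.

(** * Invariants *)

Section Invariants.
Variables (K : numClosedFieldType) (n n' : nat).
Hypothesis n_gt0 : (0 < n)%N.
Notation W := 'M[K]_(n, n').
Implicit Types x y : tbar W.

(** h is the product of the scalar l and of a matrix of determinant 1. *)
Lemma gl_act_invariant l h p x : SL_invariants K n n' x -> lin_span (words W p) x ->
  \det h != 0 -> l ^+ n = \det h -> gl_act h x = l ^+ p *: x.
Proof.
move=> xI xp h0 ln.
have l0 : l != 0 by apply: contraNneq h0 => l0; rewrite -ln l0 expr0n gtn_eqF.
have -> : h = l%:M *m (l^-1 *: h).
  by rewrite mul_scalar_mx scalerA mulfV // scale1r.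
rewrite gl_act_mul xI ?(gl_act_scalar _ xp) //.
by rewrite detZ -ln exprVn mulVf // expf_neq0.
Qed.

Lemma gl_act_invariant_det k h x : SL_invariants K n n' x ->
  lin_span (words W (k * n)) x -> \det h != 0 -> gl_act h x = \det h ^+ k *: x.
Proof.
move=> xI xk h0; have ln := Num.Theory.rootCK n_gt0 (\det h).
by rewrite (gl_act_invariant xI xk h0 ln) mulnC exprM ln.
Qed.

(** For a primitive n-th root of unity z, the scalar matrix z has determinant 1 and
    acts on degree p by z ^+ p, which differs from 1. *)
Lemma invariant_degree p x : SL_invariants K n n' x -> lin_span (words W p) x ->
  ~~ (n %| p)%N -> x = 0.
Proof.
move=> xI xp np.
have [z zn] : exists z : K, n.-primitive_root z.
  by apply: exists_prim_root => //; rewrite Num.Theory.pnatr_eq0 -lt0n.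
have : gl_act 1%:M x = z ^+ p *: x.
  (* Both 1 and z are n-th roots of the determinant of the identity. *)
  by apply: (gl_act_invariant xI xp); rewrite ?det1 ?oner_neq0 ?prim_expr_order.
rewrite (gl_act_scalar 1 xp) expr1n => /esym/eqP.
rewrite -subr_eq0 -scalerBl scaler_eq0 subr_eq0 -(prim_order_dvd zn) (negPf np).
by move/eqP.
Qed.

(** The matrices in [omega] act on x by the k-th powers of their determinants, so
    the polarization of \det ^ k appears; at elementary matrices its terms are
    products of Kronecker symbols. *)
Lemma omega_invariant k t x :
  (forall pS : {ffun 'I_k -> 'S_n} * {set 'I_(k * n)},
     \det (t%:M + \sum_(a in pS.2) omega_mx K pS.1 a) != 0) ->
  SL_invariants K n n' x -> lin_span (words W (k * n)) x ->
  omega k t x = omega_const K k n *: x.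
Proof.
move=> t_unit xI xk; rewrite /omega /omega_const scaler_suml.
apply: eq_bigr => p _; rewrite -scalerA; congr (_ *: _).
under eq_bigr => S _ do
  rewrite (gl_act_invariant_det xI xk (t_unit (p, S))) scalerA.
rewrite -scaler_suml /= polarization_det; congr (_ *: _).
apply: eq_bigr => s _; apply: eq_bigr => q _; congr (_ * _).
have [/ffunP qp|/eqP qp] := eqVneq (blocks_entry q) (reindex_ffun s (blocks_entry p)).
  by rewrite big1 // => a _; have /eqP := qp a; rewrite !ffunE xpair_eqE mxE => ->.
have [a] : exists a, blocks_entry q a != reindex_ffun s (blocks_entry p) a.
  apply/existsP; apply: contra_notT qp; rewrite negb_exists => /forallP qp.
  by apply/ffunP => a; apply/eqP; have := qp a; rewrite negbK.
rewrite !ffunE xpair_eqE => /negPf qpa.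
by rewrite (bigD1 a) //= mxE qpa mul0r.
Qed.

Lemma exists_omega k : exists2 t, omega_const K k n != 0 &
  forall x, SL_invariants K n n' x -> lin_span (words W (k * n)) x ->
  omega k t x = omega_const K k n *: x.
Proof.
have [t t_unit] := exists_det_shift_neq0
  (fun pS : {ffun 'I_k -> 'S_n} * {set 'I_(k * n)} => \sum_(a in pS.2) omega_mx K pS.1 a).
by exists t => [|x]; [apply: omega_const_neq0 | apply: omega_invariant].
Qed.

Lemma degree_part_invariant p x :
  SL_invariants K n n' x -> SL_invariants K n n' (degree_part p x).
Proof. by move=> xI g g1; rewrite gl_act_degree_part xI. Qed.

(** An invariant component of degree k * n is [omega] of itself up to a nonzero
    factor, and [omega] sends all words into the subalgebra. *)
Lemma SL_invariants_gen :
  SL_invariants K n n' = gen_subalg (det_gens K n n' `|` range (tbS W)).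
Proof.
apply/seteqP; split=> x; last first.
  apply; split.
    split=> [|a y z|y z]; rewrite !inE.
    - by move=> g _; apply: rmorph1.
    - by move=> yI zI g g1; rewrite linearP /= yI ?zI.
    - by move=> yI zI g g1; rewrite rmorphM /= yI ?zI.
  move=> y [yI|[s _ <-]] g g1; last exact: gl_act_tbS.
  by rewrite (gl_act_det_gens _ yI) g1 scale1r.
move=> xI; have [N ->] := sum_degree_parts x.
set G := gen_subalg _; apply: (@lin_span_gen_subalg _ _ _ G) => //.
apply: lin_span_sum => p _; set y := degree_part p x.
have yI : SL_invariants K n n' y by apply: degree_part_invariant.
have yp : lin_span (words W p) y by apply: degree_part_words.
have [/dvdnP[k pk]|np] := boolP (n %| p)%N; last first.
  by rewrite (invariant_degree yI yp np); apply: lin_span0.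
rewrite pk in yp; have [t c0 /(_ y yI yp) cy] := exists_omega k.
rewrite -[y]scale1r -(mulVf c0) -scalerA -cy; apply: lin_spanZ.
by apply: lin_span_gen; apply: omega_words.
Qed.

(** Here [omega] is applied to words with trivial permutation only, which keeps the
    permutations in S_(kn). *)
Lemma tensor_SL_invariants :
  tensor_alg W `&` SL_invariants K n n' =
  lin_span [set x | exists k, @det_products K n n' k x].
Proof.
apply/seteqP; split=> x.
  case=> xT xI; have [N ->] := sum_degree_parts x.
  apply: lin_span_sum => p _; set y := degree_part p x.
  have yI : SL_invariants K n n' y by apply: degree_part_invariant.
  have yp : lin_span (words W p) y by apply: degree_part_words.
  have yT : lin_span (plain_words W p) y by apply: degree_part_tensor.
  have [/dvdnP[k pk]|np] := boolP (n %| p)%N; last first.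
    by rewrite (invariant_degree yI yp np); apply: lin_span0.
  rewrite pk in yp yT; have [t c0 /(_ y yI yp) cy] := exists_omega k.
  rewrite -[y]scale1r -(mulVf c0) -scalerA -cy; apply: lin_spanZ.
  have := omega_plain_words t yT.
  by apply: lin_span_sub => z zD; apply: lin_span_gen; exists k.
move: x; apply: lin_span_ind => [x [k xD]||a x y [xT xI] [yT yI]].
- split=> [|g g1].
    have := det_products_words xD.
    by apply: lin_span_sub => _ [u _ ->]; apply: lin_span_gen; exists u.
  case: xD => [A [s [IA _ ->]]]; rewrite rmorphM /= gl_act_tbS rmorph_prod.
  by congr (_ * _); apply: eq_bigr => b _; rewrite /= (gl_act_det_gens _ (IA b)) g1 scale1r.
- by split=> [|g g1]; [apply: lin_span0 | rewrite linear0].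
- split=> [|g g1]; first exact: lin_spanP.
  by rewrite linearP /= xI ?yI.
Qed.

End Invariants.

Theorem theorem4p4 (R : realType) (n n' : nat) (hn : (1 <= n)%N) (hn' : (1 <= n')%N) :
  let W := 'M[R[i]]_(n, n') in
  let I := det_gens R[i] n n' in
  SL_invariants R[i] n n' = gen_subalg (I `|` range (tbS W))
  /\
  tensor_alg W `&` SL_invariants R[i] n n' =
    lin_span [set x : tbar W |
      exists (k : nat) (A : 'I_k -> tbar W) (s : Sinf),
        [/\ forall a, I (A a), Sfin (k * n) s
          & x = (\prod_(a < k) A a) * tbS W s]].
Proof.
by move=> W I; split; [apply: SL_invariants_gen | apply: tensor_SL_invariants].
Qed.
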